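(* Let $\Omega\subseteq[0,1]^d$ be a regular domain and $p:\Omega\to\mathbb R$ a function continuous almost everywhere. Let $\mathbf t_1,\ldots,\mathbf t_m$ and the nonzero weights $w_{[\mathbf t_k]_\alpha^+}$ be fixed and independent of $\mathbf n$, and let $W^{\Omega,p}_{\mathbf n}$ be the adjacency matrix of the $d$-level Toeplitz grid graph immersed in $\Omega$, $T^\Omega_{\mathbf n}\langle\{[\mathbf t_1],\mathbf w_1^p\},\ldots,\{[\mathbf t_m],\mathbf w_m^p\}\rangle$. Then $\{W^{\Omega,p}_{\mathbf n}\}_{\mathbf n}\sim_\lambda g$, where $g:\Omega\times[-\pi,\pi]^d\to\mathbb R$, $g(\mathbf x,\boldsymbol\theta)=p(\mathbf x)f(\boldsymbol\theta)$, with $$f(\boldsymbol\theta)=\sum_{k=1}^m\sum_{\alpha=1}^{c_k}2\,w_{[\mathbf t_k]_\alpha^+}\cos([\mathbf t_k]_\alpha^+\cdot\boldsymbol\theta).$$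
   Context: A regular domain is a Lebesgue measurable set $\Omega\subseteq[0,1]^d$ whose boundary has zero Lebesgue measure. Multi-index notation: $\vartriangleleft$ strict lexicographic order; $\mathbf i<\mathbf j$ componentwise; $|\mathbf i|$ componentwise absolute value; $\mathbf n\to\infty$ means $\min_r n_r\to\infty$. Directions: for $\mathbf t\in\mathbb Z^d_{\ge0}\setminus\{\mathbf 0\}$, $[\mathbf t]$ is the set of classes of $\{(\pm t_1,\ldots,\pm t_d)\}$ modulo $\mathbf i\sim-\mathbf i$, $c=|[\mathbf t]|$, each class $[\mathbf t]_\alpha=\{[\mathbf t]_\alpha^+,[\mathbf t]_\alpha^-\}$ with $[\mathbf t]_\alpha^+$ the element with positive first nonzero component. Here $\mathbf 0\vartriangleleft\mathbf t_1\vartriangleleft\cdots\vartriangleleft\mathbf t_m\vartriangleleft\mathbf n-\mathbf 1$, $c_k=|[\mathbf t_k]|$. The $d$-level Toeplitz graph has nodes $v_{\mathbf k}$, $\mathbf 1\le\mathbf k\le\mathbf n$, and weight $w(v_{\mathbf i},v_{\mathbf j})=w_{[\mathbf t_k]_\alpha^+}$ if $|\mathbf i-\mathbf j|=\mathbf t_k$ and $\mathbf i-\mathbf j\in[\mathbf t_k]_\alpha$, else $0$. Grid graph: with $h_r=1/(n_r+1)$, node $v_{\mathbf j}$ is identified with the point $\mathbf x_{\mathbf j}=(j_1h_1,\ldots,j_dh_d)\in(0,1)^d$, and the weight is replaced by $w^p(\mathbf x_{\mathbf i},\mathbf x_{\mathbf j})=p\big(\tfrac{\mathbf x_{\mathbf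 i}+\mathbf x_{\mathbf j}}2\big)w(v_{\mathbf i},v_{\mathbf j})$ (in the paper's construction $p$ is defined on $[0,1]^d$). The graph immersed in $\Omega$ keeps only the nodes $\mathbf x_{\mathbf j}\in\Omega$ with the restricted weight; its adjacency matrix (nodes in lexicographic order) is $W^{\Omega,p}_{\mathbf n}$, of size $n'(\mathbf n)\to\infty$. Eigenvalue distribution: $\{X_{\mathbf n}\}\sim_\lambda g$ (for $X_{\mathbf n}$ of size $d_{\mathbf n}\to\infty$ and measurable $g:D\to\mathbb R$ with $0<\mu(D)<\infty$) means $\lim_{\mathbf n\to\infty}\frac1{d_{\mathbf n}}\sum_{j=1}^{d_{\mathbf n}}F(\lambda_j(X_{\mathbf n}))=\frac1{\mu(D)}\int_DF(g(\mathbf y))d\mathbf y$ for every continuous compactly supported $F:\mathbb C\to\mathbb C$. *)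

(* Defs.v *)
From HB Require Import structures.
From mathcomp Require Import all_boot all_order all_algebra.
From mathcomp Require Import all_classical all_reals all_analysis.
From mathcomp.real_closed Require Import complex.
Set Implicit Arguments. Unset Strict Implicit. Unset Printing Implicit Defensive.
Import Order.TTheory GRing.Theory Num.Theory.
Local Open Scope ring_scope.
Local Open Scope classical_set_scope.

Record mspace (R : realType) := MSpace {
  ms_disp : measure_display;
  ms_type : measurableType ms_disp;
  ms_mu : {sigma_finite_measure set ms_type -> \bar R} }.

Section PS.
Context d1 d2 (T1 : measurableType d1) (T2 : measurableType d2) (R : realType).
Variables (m1 : {sigma_finite_measure set T1 -> \bar R}) (m2 : {sigma_finite_measure set T2 -> \bar R}).
Let pm_sf : sigma_finite setT (m1 \x m2)%E.
Proof.
have /sigma_finiteP[F [TF ndF Foo]] := sigma_finiteT m1.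
have /sigma_finiteP[G [TG ndG Goo]] := sigma_finiteT m2.
exists (fun n => F n `*` G n).
 rewrite -setXTT TF TG predeqE => -[x y]; split.
    move=> [/= [n _ Fnx] [k _ Gky]]; exists (maxn n k) => //; split.
    - by move: x Fnx; exact/subsetPset/ndF/leq_maxl.
    - by move: y Gky; exact/subsetPset/ndG/leq_maxr.
  by move=> [n _ []/= ? ?]; split; exists n.
move=> k; have [? ?] := Foo k; have [? ?] := Goo k.
split; first exact: measurableX.
by rewrite product_measure1E// lte_mul_pinfty// ge0_fin_numE.
Qed.
Definition prod_sf_fun := (m1 \x m2)%E.
HB.instance Definition _ := Measure.on prod_sf_fun.
HB.instance Definition _ := Measure_isSigmaFinite.Build _ _ _ prod_sf_fun pm_sf.
Definition prod_sf : {sigma_finite_measure set (T1 * T2)%type -> \bar R} := prod_sf_fun.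
End PS.

Fixpoint leb_prod (R : realType) (k : nat) : mspace R :=
  match k with
  | 0 => @MSpace R _ unit (@dirac _ unit tt R)
  | k.+1 => let S := leb_prod R k in
      @MSpace R _ _ (prod_sf (@lebesgue_measure R) (ms_mu S))
  end.

(* [leb_prod R k] is the k-fold product of the (Borel) Lebesgue measure on R,
   realised on nested pairs R * (R * ( ... * unit)); [lebd R k] is its
   completion, i.e. the Lebesgue measure on R^k (on Lebesgue measurable sets). *)
Definition lebd (R : realType) (k : nat) :=
  @completed_measure_extension _ _ R (ms_mu (leb_prod R k)).

Fixpoint of_nested (R : realType) (k : nat) : ms_type (leb_prod R k) -> ('I_k -> R) :=
  match k return ms_type (leb_prod R k) -> ('I_k -> R) with
  | 0 => fun _ _ => 0
  | k.+1 => fun y i => match unlift ord0 i with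
             | None => y.1 | Some i' => of_nested y.2 i' end
  end.

Definition Rpt (R : realType) (k : nat) :=
  caratheodory_type (ms_mu (leb_prod R k))^*%mu.

(* the coordinate vector of a point of the measure space (a bijection) *)
Definition vec_of (R : realType) (k : nat) (y : Rpt R k) : 'I_k -> R :=
  @of_nested R k y.

Definition lebV (R : realType) (k : nat) (A : set ('I_k -> R)) : \bar R :=
  @lebd R k (@vec_of R k @^-1` A).
Definition leb_measurable (R : realType) (k : nat) (A : set ('I_k -> R)) : Prop :=
  measurable (@vec_of R k @^-1` A : set (Rpt R k)).
Definition leb_negligible (R : realType) (k : nat) (A : set ('I_k -> R)) : Prop :=
  (@lebd R k).-negligible (@vec_of R k @^-1` A).
Definition leb_integral (R : realType) (k : nat) (A : set ('I_k -> R))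
    (h : ('I_k -> R) -> R) : R :=
  Rintegral (@lebd R k) (@vec_of R k @^-1` A) (h \o @vec_of R k).

Local Open Scope complex_scope.
Local Open Scope ring_scope.

Definition ccontinuous (R : realType) (F : R[i] -> R[i]) : Prop :=
  forall (z : R[i]) (e : R), 0 < e ->
    exists2 del : R, 0 < del &
      forall z' : R[i], `|z' - z| < del%:C -> `|F z' - F z| < e%:C.

Definition csupported (R : realType) (F : R[i] -> R[i]) : Prop :=
  exists M : R, forall z : R[i], M%:C < `|z| -> F z = 0.

Definition eigs (R : realType) (N : nat) (A : 'M[R]_N) : seq R[i] :=
  xget [::] [set s : seq R[i] |
    char_poly (map_mx (fun x : R => x%:C) A) = \prod_(z <- s) ('X - z%:P)].

Definition eig_distributed (R : realType) (d : nat) (dn : ('I_d -> nat) -> nat)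
    (X : forall n : 'I_d -> nat, 'M[R]_(dn n))
    (k : nat) (D : set ('I_k -> R)) (g : ('I_k -> R) -> R) : Prop :=
  forall F : R[i] -> R[i], ccontinuous F -> csupported F ->
  forall e : R, 0 < e -> exists N : nat, forall n : 'I_d -> nat,
    (forall r, (N <= n r)%N) ->
    `| (dn n)%:R^-1%:C * \sum_(z <- eigs (X n)) F z
       - (fine (lebV D))^-1%:C *
         (leb_integral D (fun y => complex.Re (F (g y)%:C)) +i*
          leb_integral D (fun y => complex.Im (F (g y)%:C))) | < e%:C.

Definition in_unit_cube (R : realType) (d : nat) (Om : set ('I_d -> R)) : Prop :=
  forall x, Om x -> forall r, 0 <= x r <= 1.

Definition boundary (R : realType) (d : nat) (Om : set ('I_d -> R)) : set ('I_d -> R) :=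
  [set x | forall del : R, 0 < del ->
     (exists y, Om y /\ forall r, `|y r - x r| < del) /\
     (exists y, ~ Om y /\ forall r, `|y r - x r| < del)].

Definition regular_domain (R : realType) (d : nat) (Om : set ('I_d -> R)) : Prop :=
  [/\ in_unit_cube Om, leb_measurable Om & lebV (boundary Om) = 0%E].

Definition ae_continuous_on (R : realType) (d : nat) (Om : set ('I_d -> R))
    (p : ('I_d -> R) -> R) : Prop :=
  leb_negligible [set x | Om x /\ ~ (forall e : R, 0 < e -> exists2 del : R, 0 < del &
     forall y, Om y -> (forall r, `|y r - x r| < del) -> `|p y - p x| < e)].

Definition lexlt (d : nat) (a b : 'I_d -> nat) : Prop :=
  exists r : 'I_d, (a r < b r)%N /\ forall r' : 'I_d, (r' < r)%N -> a r' = b r'.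

Definition posrep (d : nat) (v : {ffun 'I_d -> int}) : bool :=
  [exists r : 'I_d, (0 < v r) && [forall r' : 'I_d, (r' < r)%N ==> (v r' == 0)]].

Definition signed_vec (d : nat) (t : 'I_d -> nat) (s : {ffun 'I_d -> bool}) :
    {ffun 'I_d -> int} :=
  [ffun r => if s r then - (t r)%:Z else (t r)%:Z].

(* [t]_1^+, ..., [t]_c^+ : the representatives with positive first nonzero
   component of the classes of {(+-t_1, ..., +-t_d)} modulo i ~ -i *)
Definition class_reps (d : nat) (t : 'I_d -> nat) : seq {ffun 'I_d -> int} :=
  [seq v <- undup [seq signed_vec t s | s <- enum {ffun 'I_d -> bool}] | posrep v].

Definition canon (d : nat) (v : {ffun 'I_d -> int}) : {ffun 'I_d -> int} :=
  if posrep v then v else [ffun r => - v r].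

(* multi-indices 1 <= j <= n, stored zero-based: j r : 'I_(n r) stands for j_r = j r + 1 *)
Definition Idx (d : nat) (n : 'I_d -> nat) : finType := {dffun forall r : 'I_d, 'I_(n r)}.

Definition gridpt (R : realType) (d : nat) (n : 'I_d -> nat) (j : Idx n) : 'I_d -> R :=
  fun r => (val (j r)).+1%:R / (n r).+1%:R.

(* weight w(v_i, v_j) of the d-level Toeplitz graph: the weight attached to
   [t_k]_alpha^+ (given by w) if |i - j| = t_k and i - j in [t_k]_alpha *)
Definition toeplitz_weight (R : realType) (d m : nat) (t : 'I_m -> 'I_d -> nat)
    (w : {ffun 'I_d -> int} -> R) (n : 'I_d -> nat) (i j : Idx n) : R :=
  let v := [ffun r => (val (i r))%:Z - (val (j r))%:Z] in
  if [exists k : 'I_m, [forall r : 'I_d, absz (v r) == t k r]] then w (canon v) else 0.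

Definition grid_weight (R : realType) (d m : nat) (t : 'I_m -> 'I_d -> nat)
    (w : {ffun 'I_d -> int} -> R) (p : ('I_d -> R) -> R) (n : 'I_d -> nat)
    (i j : Idx n) : R :=
  p (fun r => (gridpt R i r + gridpt R j r) / 2) * toeplitz_weight t w i j.

Definition nodes (R : realType) (d : nat) (Om : set ('I_d -> R)) (n : 'I_d -> nat) :
    {set Idx n} := [set j | `[< Om (gridpt R j) >]].

Definition Wmat (R : realType) (d m : nat) (t : 'I_m -> 'I_d -> nat)
    (w : {ffun 'I_d -> int} -> R) (Om : set ('I_d -> R)) (p : ('I_d -> R) -> R)
    (n : 'I_d -> nat) : 'M[R]_#|nodes Om n| :=
  \matrix_(a, b) grid_weight t w p (enum_val a) (enum_val b).

Definition dotZ (R : realType) (d : nat) (v : {ffun 'I_d -> int}) (th : 'I_d -> R) : R :=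
  \sum_(r < d) (v r)%:~R * th r.

Definition symbol (R : realType) (d m : nat) (t : 'I_m -> 'I_d -> nat)
    (w : {ffun 'I_d -> int} -> R) (th : 'I_d -> R) : R :=
  \sum_(k < m) \sum_(v <- class_reps (t k)) 2 * w v * cos (dotZ v th).

Definition xpart (R : realType) (d : nat) (z : 'I_(d + d) -> R) : 'I_d -> R :=
  fun r => z (lshift d r).
Definition thpart (R : realType) (d : nat) (z : 'I_(d + d) -> R) : 'I_d -> R :=
  fun r => z (rshift d r).

Definition OmXcube (R : realType) (d : nat) (Om : set ('I_d -> R)) : set ('I_(d + d) -> R) :=
  [set z | Om (xpart z) /\ forall r, - pi <= thpart z r <= pi].

(* Main.v *)
Require Import Defs.
From HB Require Import structures.
From mathcomp Require Import all_boot all_order all_algebra.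
From mathcomp Require Import all_classical all_reals all_analysis.
From mathcomp Require Import measurable_realfun.
From mathcomp.real_closed Require Import complex.
From mathcomp Require Import ring lra zify.
Set Implicit Arguments. Unset Strict Implicit. Unset Printing Implicit Defensive.
Import Order.TTheory GRing.Theory Num.Theory.
Import numFieldNormedType.Exports.
Local Open Scope ring_scope.
Local Open Scope classical_set_scope.

(* For a symmetric matrix, sum_j F(lambda_j) is the sum over the nodes i of the integral of F
   against the spectral measure mu_i of the basis vector e_i, whose k-th moment is (W^k)_ii. This
   entry only depends on the weights within bounded distance of i.  If y is interior to Omega and
   p is continuous at y, then, for the node i_n whose grid cell contains y, (W_n^k)_{i_n i_n}
   converges to p(y)^k times the constant Fourier coefficient of f^k.  The uniform measure on the
   values p(x_{i_n}) f(theta), theta in a finer and finer regular grid of [-pi, pi]^d, has the same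
   limit moments, by discrete orthogonality of the characters.  Hence by Weierstrass' theorem the
   integral of F against mu_{i_n} minus the grid average of F(p(x_{i_n}) f(theta)) tends to 0 for
   almost every y.  By dominated convergence the average of this difference over all nodes
   vanishes in the limit, and what remains is a Riemann sum of F(p f) over
   Omega x [-pi, pi]^d. *)

(** * Null sets and boxes for the nested Lebesgue measure *)

(** The function [p] may be unbounded, so the norms of the matrices need not be bounded and their
    normalised traces need not converge. Hence moments are compared only at one node at a time,
    where [p] stays close to [p y], and only integrals of the bounded [F] are averaged over the
    nodes. The midpoint of two nodes may lie outside [Om], where [p] is arbitrary; this too is
    harmless near an interior point. Only double stochasticity of the spectral weights links the two
    levels: row sums 1 make each spectral measure a probability, column sums 1 make these measures
    add up to the whole spectrum. Neither [p] nor the product domain is known to be measurable.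
    Measurability is obtained as an output of the Riemann sums, whose step functions converge almost
    everywhere for a complete measure. *)

Section nested_boxes.
Variable R : realType.

Lemma nested_box_measure (k : nat) (a b : 'I_k -> R) : (forall r, a r <= b r) ->
  measurable [set y : ms_type (leb_prod R k) | forall r, a r < of_nested y r <= b r] /\
  ms_mu (leb_prod R k) [set y | forall r, a r < of_nested y r <= b r] =
  (\prod_(r < k) (b r - a r))%:E.
Proof.
elim: k a b => [|k IH] a b ab.
  have -> : [set y : ms_type (leb_prod R 0) | forall r, a r < of_nested y r <= b r] = setT.
    by apply/seteqP; split=> // y _ [].
  by split; [exact: measurableT|rewrite big_ord0 /= diracT].
set B := [set y : ms_type (leb_prod R k) |
   forall r, a (lift ord0 r) < of_nested y r <= b (lift ord0 r)].
have [mB muB] := IH (a \o lift ord0) (b \o lift ord0) (fun r => ab _).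
have -> : [set y : ms_type (leb_prod R k.+1) | forall r, a r < of_nested y r <= b r] =
    `]a ord0, b ord0] `*` B.
  apply/seteqP; split=> [[x y]|[x y]] /=.
    move=> h; split=> /=; first by have := h ord0; rewrite /= unlift_none in_itv.
    by move=> r; have := h (lift ord0 r); rewrite /= liftK.
  move=> [/= h1 h2] r; case: unliftP => [r' ->|->]; first exact: h2.
  by move: h1; rewrite in_itv.
split; first exact: measurableX.
rewrite /= /prod_sf_fun product_measure1E//.
rewrite [X in (X * _)%E](lebesgue_measure_itv (`]a ord0, b ord0])%R) /= lte_fin.
rewrite [X in (_ * X)%E]muB big_ord_recl EFinM.
congr (_ * _)%E; case: ltP => // h.
by rewrite (_ : b ord0 = a ord0) ?subrr//; apply/eqP; rewrite eq_le h ab.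
Qed.

(** The product measure is by definition the integral of the nonnegative section measure, and such
    an integral vanishes exactly when the integrand is null almost everywhere. *)
Lemma prod_null_sections d1 d2 (T1 : measurableType d1) (T2 : measurableType d2)
   (m1 : {sigma_finite_measure set T1 -> \bar R})
   (m2 : {sigma_finite_measure set T2 -> \bar R}) (A : set (T1 * T2)) :
  measurable A ->
  (prod_sf m1 m2 A = 0 <-> \forall x \ae m1, m2 (xsection A x) = 0%E).
Proof.
move=> mA; rewrite /= /prod_sf_fun /product_measure1.
have mf := measurable_fun_xsection m2 mA.
rewrite (_ : (\int[m1]_x _ = \int[m1]_x `|(m2 \o xsection A) x|)%E); last first.
  by apply: eq_integral => x _; rewrite gee0_abs.
split=> [/(ae_eq_integral_abs m1 measurableT mf)|h].
  by apply: filterS => x /(_ I).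
apply/(ae_eq_integral_abs m1 measurableT mf).
by apply: filterS h => x + _.
Qed.

Fixpoint nested_pr1 (d e : nat) : ms_type (leb_prod R (d + e)) -> ms_type (leb_prod R d) :=
  match d with
  | 0 => fun _ => tt
  | d.+1 => fun y => (y.1, @nested_pr1 d e y.2)
  end.

Lemma measurable_nested_pr1 d e : measurable_fun setT (@nested_pr1 d e).
Proof.
elim: d => [|d IH] /=; first exact: measurable_cst.
apply: measurable_fun_pair; first exact: measurable_fst.
by apply: measurableT_comp => //; exact: measurable_snd.
Qed.

Lemma of_nested_pr1 d e (y : ms_type (leb_prod R (d + e))) r :
  of_nested (nested_pr1 y) r = of_nested y (lshift e r).
Proof.
elim: d y r => [|d IH] y r; first by case: r.
rewrite /=; case: unliftP => [r' ->|->].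
  rewrite IH; have -> : lshift e (lift ord0 r') = lift ord0 (lshift e r') by exact/val_inj.
  by rewrite liftK.
have -> : lshift e (@ord0 d) = ord0 by exact/val_inj.
by rewrite unlift_none.
Qed.

(** By induction on sections in the first coordinate. At the base the Dirac mass charges the only
    point of [unit], so a null set is empty. This carries exceptional sets in x over to pairs (x,
    theta). *)
Lemma nested_pr1_null d e (B : set (ms_type (leb_prod R d))) :
  measurable B -> ms_mu (leb_prod R d) B = 0 ->
  ms_mu (leb_prod R (d + e)) (@nested_pr1 d e @^-1` B) = 0.
Proof.
elim: d B => [|d IH] B mB.
  move=> /= B0; suff -> : B = set0 by rewrite preimage_set0 measure0.
  apply/seteqP; split=> // -[] Bt; move: B0; rewrite /= diracE mem_set//.
  by move/eqP; rewrite onee_eq0.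
move=> /(prod_null_sections _ _ mB) h; apply/prod_null_sections.
  by rewrite -[X in measurable X]setTI; apply: (@measurable_nested_pr1 d.+1 e).
apply: filterS h => x; apply: IH; exact: measurable_xsection.
Qed.

Lemma nested_hyperplane k (c : R) (i : 'I_k) :
  measurable [set y : ms_type (leb_prod R k) | of_nested y i = c] /\
  ms_mu (leb_prod R k) [set y : ms_type (leb_prod R k) | of_nested y i = c] = 0.
Proof.
elim: k i => [|k IH] [i ik] //.
case: (unliftP ord0 (Ordinal ik)) => [j ->|->].
  have [mj zj] := IH j.
  have -> : [set y : ms_type (leb_prod R k.+1) | of_nested y (lift ord0 j) = c] =
     setT `*` [set y : ms_type (leb_prod R k) | of_nested y j = c].
    by apply/seteqP; split=> [[x y]|[x y]] /=; rewrite liftK //; case.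
  split; first exact: measurableX.
  by rewrite /= /prod_sf_fun product_measure1E// [X in (_ * X)%E]zj mule0.
have -> : [set y : ms_type (leb_prod R k.+1) | of_nested y ord0 = c] = [set c] `*` setT.
  by apply/seteqP; split=> [[x y]|[x y]] /=; rewrite unlift_none //; case.
split; first exact: measurableX.
by rewrite /= /prod_sf_fun product_measure1E// [X in (X * _)%E](lebesgue_measure_set1 c) mul0e.
Qed.

(** Covers of outer measure at most 1/(n+1) are intersected over n. The measurable hull is what can
    be pulled back through a product measure, which is defined before completion. *)
Lemma lebd_negligibleP k (A : set (Rpt R k)) :
  (@lebd R k).-negligible A <->
  exists B : set (ms_type (leb_prod R k)),
    [/\ measurable B, ms_mu (leb_prod R k) B = 0 & A `<=` B].
Proof.
split=> [[C [mC C0 AC]]|[B [mB B0 AB]]]; last first.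
  exists B; split => //; last by rewrite /lebd /completed_measure_extension measurable_mu_extE.
  exact: caratheodory_measurable_mu_ext.
have cov n : exists B : set (ms_type (leb_prod R k)),
    [/\ measurable B, (ms_mu (leb_prod R k) B <= n.+1%:R^-1%:E)%E & C `<=` B].
  have : ((ms_mu (leb_prod R k))^*%mu C < n.+1%:R^-1%:E)%E.
    by rewrite [X in (X < _)%E]C0 lte_fin invr_gt0.
  move/ereal_inf_lt => [_ [F [mF CF] <-]] h.
  exists (\bigcup_i F i); split => //; first exact: bigcupT_measurable.
  apply: le_trans (ltW h).
  by apply: measure_sigma_subadditive => //; exact: bigcupT_measurable.
pose B n := projT1 (cid (cov n)).
have hB n := projT2 (cid (cov n)).
have mB : measurable (\bigcap_n B n).
  by apply: bigcapT_measurable => n; have [] := hB n.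
exists (\bigcap_n B n); split => //; last first.
  by move=> x /AC Cx n _; have [_ _] := hB n; apply.
apply/eqP; rewrite eq_le measure_ge0 andbT; apply/lee_addgt0Pr => e e0.
have [n ne] : exists n : nat, n.+1%:R^-1 < e.
  by have [n] := ltr_add_invr e0; rewrite add0r; exists n.
have [m1 m2 _] := hB n.
rewrite add0e (le_trans _ (ltW _ : (n.+1%:R^-1%:E <= e%:E)%E)) ?lte_fin//.
apply: le_trans m2; apply: le_measure; rewrite ?inE//.
by move=> x; apply.
Qed.
End nested_boxes.

(** * Riemann sums *)

(** Measurability of the limit [f] is a conclusion: off a null set [f] is a limit of measurable
    functions, and completeness does the rest. *)
Lemma complete_dominated_convergence d (T : measurableType d) (R : realType)
    (mu : {measure set T -> \bar R}) (f_ : nat -> T -> R) (f g : T -> R) (Z : set T) :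
  measure_is_complete mu -> mu.-negligible Z ->
  (forall n, measurable_fun setT (f_ n)) ->
  (forall x, ~ Z x -> f_ ^~ x @ \oo --> f x) ->
  mu.-integrable setT (EFin \o g) ->
  (forall n x, `|f_ n x| <= g x) ->
  [/\ measurable_fun setT f, mu.-integrable setT (EFin \o f) &
   (fun n => \int[mu]_x f_ n x)%R @ \oo --> (\int[mu]_x f x)%R].
Proof.
move=> cmu [N [mN N0 ZN]] mf_ f_f ig f_g.
have mf : measurable_fun setT f.
  apply/measurable_EFinP.
  have mNf : measurable_fun (~` N) (EFin \o f).
    apply: (@emeasurable_fun_cvg _ _ _ (~` N) (fun n => EFin \o f_ n)).
      by move=> n; apply/measurable_EFinP; apply: measurable_funS (mf_ n).
    by move=> x xN; apply: cvg_EFin; [exact: nearW|apply: f_f => /ZN].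
  have mCN : measurable (~` N) by exact: measurableC.
  apply: (ae_measurable_fun cmu _ ((measurable_restrictT _ mCN).1 mNf)).
  exists N; split=> // x /= /not_implyP[_]; apply: contra_notP => xN.
  by rewrite patchE mem_set.
have [] := @dominated_convergence _ _ _ mu setT measurableT (fun n => EFin \o f_ n)
  (EFin \o f) (EFin \o g).
- by move=> n; apply/measurable_EFinP.
- by apply/measurable_EFinP.
- exists N; split=> // x /= /not_implyP[_] h; apply: ZN; apply: contrapT => nZ; apply: h.
  by apply: cvg_EFin; [exact: nearW|exact: f_f].
- exact: ig.
- by apply: aeW => x n _ /=; rewrite lee_fin.
move=> fi _ fc; split => //.
apply: fine_cvg; rewrite fineK//; exact: integrable_fin_num.
Qed.

Lemma integrable_indic_fin d (T : measurableType d) (R : realType)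
    (mu : {measure set T -> \bar R}) (A : set T) :
  measurable A -> (mu A < +oo)%E -> mu.-integrable setT (EFin \o \1_A).
Proof.
move=> mA Aoo; apply/integrableP; split.
  by apply/measurable_EFinP; apply/measurable_indicP.
rewrite (eq_integral (EFin \o \1_A)); last first.
  by move=> x _ /=; rewrite ger0_norm// indicE.
by rewrite integral_indic// setIT.
Qed.

Section riemann_sums.
Variable R : realType.

(** Half open, so that the cells of a grid are disjoint. The upper corner serves as sample point:
    with [a = 0] and [h = 1 / (n + 1)] it is [gridpt], whose indices are also stored from zero. *)
Definition cell (k : nat) (a h : 'I_k -> R) (j : 'I_k -> nat) : set ('I_k -> R) :=
  [set y | forall r, a r + (j r)%:R * h r < y r <= a r + (j r).+1%:R * h r].

Lemma lebd_complete (k : nat) : measure_is_complete (@lebd R k).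
Proof. exact: measure_is_complete_caratheodory. Qed.

Lemma lebd_box (k : nat) (a b : 'I_k -> R) : (forall r, a r <= b r) ->
  measurable [set y : Rpt R k | forall r, a r < vec_of y r <= b r] /\
  @lebd R k [set y | forall r, a r < vec_of y r <= b r] = (\prod_(r < k) (b r - a r))%:E.
Proof.
move=> ab; have [m1 m2] := nested_box_measure ab; split.
  exact: caratheodory_measurable_mu_ext.
by rewrite -m2 /lebd /completed_measure_extension measurable_mu_extE.
Qed.

Lemma cell_measure (k : nat) (a h : 'I_k -> R) (j : 'I_k -> nat) : (forall r, 0 <= h r) ->
  measurable (@vec_of R k @^-1` cell a h j) /\
  @lebd R k (@vec_of R k @^-1` cell a h j) = (\prod_(r < k) h r)%:E.
Proof.
move=> h0; have [] := @lebd_box k (fun r => a r + (j r)%:R * h r)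
  (fun r => a r + (j r).+1%:R * h r); last first.
  move=> m1 m2; split=> //; rewrite [LHS]m2; congr (_%:E); apply: eq_bigr => r _.
  by rewrite -[(j r).+1%:R]natr1; ring.
by move=> r; rewrite lerD2l ler_wpM2r// ler_nat.
Qed.

Lemma cell_inj (k : nat) (a h : 'I_k -> R) (i j : 'I_k -> nat) y : (forall r, 0 < h r) ->
  cell a h i y -> cell a h j y -> i =1 j.
Proof.
move=> h0 iy jy r; apply/eqP; rewrite eqn_leq.
have aux u v : cell a h u y -> cell a h v y -> (u r <= v r)%N.
  move=> /(_ r) /andP[uy _] /(_ r) /andP[_ vy].
  by have := lt_le_trans uy vy; rewrite ltrD2l ltr_pM2r// ltr_nat ltnS.
by apply/andP; split; exact: aux.
Qed.

Lemma cell_coord (a h x : R) (n : nat) : 0 < h -> a < x -> x <= a + n%:R * h ->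
  exists2 j, (j < n)%N & a + j%:R * h < x <= a + j.+1%:R * h.
Proof.
move=> h0 ax xn.
have ex : exists n, x <= a + n%:R * h by exists n.
case: (ex_minnP ex) => -[|j] xj jmin.
  by move: xj; rewrite mul0r addr0 leNgt ax.
exists j; first exact: jmin.
by rewrite xj andbT ltNge; apply/negP => /jmin; rewrite ltnn.
Qed.

(** [N] fixes the step and [n] counts the indexed cells. The slack of one covers both uses: the
    nodes have step 1/(n+1) and leave the last layer of cells unindexed, the angles fill their
    interval with [n = N]. *)
Variables (k : nat) (a L : 'I_k -> R) (n N : nat -> 'I_k -> nat).
Hypothesis L0 : forall r, 0 < L r.
Hypothesis sn : forall s r, (s < n s r)%N.
Hypothesis nN : forall s r, (n s r <= N s r <= (n s r).+1)%N.

Let h s r : R := L r / (N s r)%:R.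

Let N0 s r : (0 < N s r)%N.
Proof. by apply: leq_trans (proj1 (andP (nN s r))); exact: leq_trans (sn s r). Qed.

Let h0 s r : 0 < h s r.
Proof. by rewrite divr_gt0// ltr0n. Qed.

Let box_ex (y : 'I_k -> R) : (forall r, a r < y r < a r + L r) ->
  \forall s \near \oo, exists j : Idx (n s), cell a (h s) (fun r => j r) y.
Proof.
move=> ay.
have : \forall s \near \oo, forall r, y r <= a r + (n s r)%:R * h s r.
  apply: filter_forall => r.
  have /andP[_ yL] := ay r.
  (* For [s >= c] the step L/N is at most the distance from [y] to the upper face, which puts [y]
     below the layer that may be unindexed. *)
  pose c := L r / (a r + L r - y r).
  have c0 : 0 < a r + L r - y r by rewrite subr_gt0.
  near=> s.
  have cs : c <= s%:R by near: s; exact: nbhs_infty_ger.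
  have /andP[nN1 nN2] := nN s r.
  have NR : 0 < (N s r)%:R :> R by rewrite ltr0n.
  have : (N s r)%:R - 1 <= (n s r)%:R :> R.
    by rewrite lerBlDr natr1 ler_nat.
  have : s%:R <= (N s r)%:R :> R by rewrite ler_nat (leq_trans (ltnW (sn s r))).
  move=> sN Nn.
  have cN : L r <= (N s r)%:R * (a r + L r - y r).
    by rewrite -ler_pdivrMr// (le_trans cs).
  rewrite /h mulrA -lerBlDl ler_pdivlMr//.
  have : L r * ((N s r)%:R - 1) <= L r * (n s r)%:R by rewrite ler_wpM2l// ltW.
  by move: cN; lra.
apply: filterS => s hs.
have hr r : exists2 j, (j < n s r)%N & a r + j%:R * h s r < y r <= a r + j.+1%:R * h s r.
  apply: cell_coord => //; by have /andP[] := ay r.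
pose f r := projT1 (cid2 (hr r)).
have fP r : (f r < n s r)%N by rewrite /f; case: cid2.
exists [ffun r => Ordinal (fP r)] => r; rewrite ffunE /f /=.
by case: cid2.
Unshelve. all: by end_near. Qed.


Variables (u : forall s, Idx (n s) -> R) (C : R) (D : set ('I_k -> R))
  (f : ('I_k -> R) -> R) (Z : set (Rpt R k)).
Arguments u : clear implicits.
Hypothesis uC : forall s j, `|u s j| <= C.
Hypothesis DL : forall y, D y -> forall r, a r <= y r <= a r + L r.
Hypothesis Z0 : (@lebd R k).-negligible Z.
Hypothesis uf : forall y : Rpt R k, ~ Z y ->
  (forall r, a r < vec_of y r < a r + L r) ->
  forall j : forall s, Idx (n s),
  (\forall s \near \oo, cell a (h s) (fun r => j s r) (vec_of y)) ->
  (fun s => u s (j s)) @ \oo --> (f \_ D) (vec_of y).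

Let step s (y : Rpt R k) : R :=
  \sum_j u s j * \1_(@vec_of R k @^-1` cell a (h s) (fun r => j r)) y.

Let stepE s (j : Idx (n s)) y : cell a (h s) (fun r => j r) (vec_of y) -> step s y = u s j.
Proof.
move=> jy; rewrite /step (bigD1 j)//= indicE mem_set//= mulr1 big1 ?addr0// => i ij.
rewrite indicE memNset ?mulr0// => iy; move/negP: ij; apply; apply/eqP/ffunP => r.
by apply/val_inj; apply: (cell_inj (h0 s) iy jy).
Qed.

Let step0 s y : (forall j : Idx (n s), ~ cell a (h s) (fun r => j r) (vec_of y)) ->
  step s y = 0.
Proof.
by move=> jy; rewrite /step big1// => i _; rewrite indicE memNset ?mulr0//; exact: jy.
Qed.

Let cell_box s (j : Idx (n s)) y : cell a (h s) (fun r => j r) y ->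
  forall r, a r < y r <= a r + L r.
Proof.
move=> + r => /(_ r) /andP[y1 y2]; apply/andP; split.
  by apply: le_lt_trans y1; rewrite lerDl mulr_ge0// ltW.
apply: le_trans y2 _; rewrite lerD2l /h mulrCA ger_pMr// ler_pdivrMr ?ltr0n// mul1r ler_nat.
by apply: leq_trans (ltn_ord _) _; have /andP[] := nN s r.
Qed.

Let mstep s : measurable_fun setT (step s).
Proof.
apply: measurable_sum => j; apply: measurable_funM => //.
by apply/measurable_indicP; have [] := cell_measure a (fun r => j r) (fun r => ltW (h0 s r)).
Qed.

Let integral_step s :
  (\int[@lebd R k]_y step s y)%R = \prod_r h s r * \sum_j u s j.
Proof.
rewrite /Rintegral.
under eq_integral do rewrite /step -sumEFin.
have ind (j : Idx (n s)) : (@lebd R k).-integrable setT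
    (EFin \o \1_(@vec_of R k @^-1` cell a (h s) (fun r => j r))).
  have [m1 m2] := cell_measure a (fun r => j r) (fun r => ltW (h0 s r)).
  by apply: integrable_indic_fin => //; rewrite [X in (X < _)%E]m2 ltry.
rewrite integral_sum//; last first.
  by move=> j; apply: (@integrableZl _ _ _ (@lebd R k) _ _ (u s j) _ (ind j)).
rewrite mulr_sumr.
rewrite (eq_bigr (fun j => (\prod_r h s r * u s j)%:E)) ?sumEFin// => j _.
have [m1 m2] := cell_measure a (fun r => j r) (fun r => ltW (h0 s r)).
under eq_integral do rewrite EFinM.
rewrite integralZl//; last exact: ind.
by rewrite integral_indic// setIT [X in (_ * X)%E]m2 -EFinM mulrC.
Qed.

(** The Riemann sum is exactly the integral of [step s], which is dominated by [C] on the box and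
    converges almost everywhere by [uf]. *)
Lemma riemann_sum_cvg :
  [/\ measurable_fun setT (f \_ D \o @vec_of R k),
     (@lebd R k).-integrable setT (EFin \o (f \_ D \o @vec_of R k)) &
  (fun s => \prod_r (L r / (N s r)%:R) * \sum_j u s j) @ \oo --> leb_integral D f].
Proof.
pose B := [set y : Rpt R k | forall r, a r < vec_of y r <= a r + L r].
have [mB lB] : measurable B /\ @lebd R k B = (\prod_(r < k) L r)%:E.
  have [|m1 m2] := @lebd_box k a (fun r => a r + L r).
    by move=> r; rewrite lerDl ltW.
  by split => //; rewrite m2; congr (_%:E); apply: eq_bigr => r _; ring.
(* The faces of the box, on which [uf] says nothing. *)
pose H := [set y : Rpt R k | exists r, vec_of y r = a r \/ vec_of y r = a r + L r].
have H0 : (@lebd R k).-negligible H.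
  have -> : H = \big[setU/set0]_(r : 'I_k)
     ([set y : Rpt R k | vec_of y r = a r] `|` [set y | vec_of y r = a r + L r]).
    rewrite -bigcup_seq; apply/seteqP; split=> y /=; first by case=> r hr; exists r => //=; rewrite mem_index_enum.
    by case=> r _ hr; exists r.
  apply: (big_ind (fun A => (@lebd R k).-negligible A)) => [|A B'|r _].
  - exact: negligible_set0.
  - exact: negligibleU.
  apply: negligibleU; apply/lebd_negligibleP.
    by have [m1 m2] := nested_hyperplane (a r) r; exists [set y | of_nested y r = a r]; split.
  by have [m1 m2] := nested_hyperplane (a r + L r) r; exists [set y | of_nested y r = a r + L r]; split.
have C0 : 0 <= C by apply: le_trans (uC (s := 0) [ffun r => Ordinal (sn 0 r)]).
have [||||m1 m2 m3] := @complete_dominated_convergence _ _ _ (@lebd R k) step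
  (f \_ D \o @vec_of R k) (fun y => C * \1_B y) (Z `|` H) (@lebd_complete k) _ mstep.
- exact: negligibleU.
- move=> y ZHy.
  have Zy : ~ Z y by move=> Zy; apply: ZHy; left.
  have Hy : ~ H y by move=> Hy; apply: ZHy; right.
  have [ay|nay] := pselect (forall r, a r < vec_of y r < a r + L r).
    (* An arbitrary index stands in when no cell contains the point, which by [box_ex] happens for
       finitely many [s] only. *)
    have exj s : exists j : Idx (n s),
      (exists j : Idx (n s), cell a (h s) (fun r => j r) (vec_of y)) ->
      cell a (h s) (fun r => j r) (vec_of y).
      have [[j jy]|nj] := pselect (exists j : Idx (n s), cell a (h s) (fun r => j r) (vec_of y)).
        by exists j.
      by exists [ffun r => Ordinal (sn s r)] => /nj.
    pose j s := projT1 (cid (exj s)).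
    have jP : \forall s \near \oo, cell a (h s) (fun r => j s r) (vec_of y).
      by apply: filterS (box_ex ay) => s; rewrite /j; case: cid.
    apply: cvg_trans (uf Zy ay jP); apply: near_eq_cvg.
    by apply: filterS jP => s /stepE ->.
  have [r yr] : exists r, ~~ (a r <= vec_of y r <= a r + L r).
    apply: contra_notP nay => /forallNP yr r.
    have /negP/negPn := yr r.
    rewrite !le_eqVlt => /andP[/orP[/eqP e|->] /orP[/eqP e'|->]] //.
    + by case: Hy; exists r; left.
    + by case: Hy; exists r; left.
    + by case: Hy; exists r; right.
  rewrite /= patchE memNset; last by move=> /DL /(_ r); rewrite (negbTE yr).
  apply: cvg_near_cst; apply: nearW => s; apply: step0 => j /cell_box /(_ r) /andP[y1 y2].
  by rewrite (ltW y1) y2 in yr.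
- have indB : (@lebd R k).-integrable setT (EFin \o \1_B).
    by apply: integrable_indic_fin => //; rewrite [X in (X < _)%E]lB ltry.
  exact: (@integrableZl _ _ _ (@lebd R k) _ measurableT C _ indB).
- move=> s y; have [[j jy]|nj] := pselect (exists j : Idx (n s), cell a (h s) (fun r => j r) (vec_of y)).
    rewrite (stepE jy) indicE mem_set ?mulr1//.
    by move=> r; apply: (cell_box jy).
  rewrite step0 ?normr0 ?mulr_ge0// => j jy.
  by apply: nj; exists j.
split => //; rewrite /leb_integral.
rewrite (_ : Rintegral _ _ _ = (\int[@lebd R k]_y (f \_ D \o @vec_of R k) y)%R); last first.
  rewrite /Rintegral integral_mkcond; congr fine; apply: eq_integral => y _.
  rewrite /= !patchE; have [Dy|Dy] := pselect (D (vec_of y)).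
    by rewrite !mem_set.
  by rewrite !memNset.
by apply: cvg_trans m3; apply: near_eq_cvg; apply: nearW => s; rewrite integral_step.
Qed.
End riemann_sums.

Lemma negligible_xpart (R : realType) (d e : nat) (A : set ('I_d -> R)) :
  leb_negligible A ->
  (@lebd R (d + e)).-negligible [set y : Rpt R (d + e) | A (fun r => vec_of y (lshift e r))].
Proof.
move=> /lebd_negligibleP[B [mB B0 AB]]; apply/lebd_negligibleP.
exists (@nested_pr1 R d e @^-1` B); split.
- by rewrite -[X in measurable X]setTI; apply: measurable_nested_pr1.
- exact: nested_pr1_null.
move=> y /= Ay; apply: AB; rewrite /=.
rewrite (_ : vec_of _ = fun r => vec_of y (lshift e r))//.
by apply/funext => r; exact: of_nested_pr1.
Qed.

(** * Spectral measures of a symmetric matrix *)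

Section spectral_weights.
Local Open Scope complex_scope.
Local Open Scope ring_scope.
Variable R : realType.

Lemma char_poly_conj (F : fieldType) (n : nat) (P D : 'M[F]_n) : P \in unitmx ->
  char_poly (invmx P *m D *m P) = char_poly D.
Proof.
move=> Pu; rewrite /char_poly /char_poly_mx.
have PI : map_mx polyC (invmx P) *m map_mx polyC P = 1%:M by rewrite -map_mxM mulVmx// map_mx1.
have -> : 'X%:M - map_mx polyC (invmx P *m D *m P) =
    map_mx polyC (invmx P) *m ('X%:M - map_mx polyC D) *m map_mx polyC P.
  by rewrite mulmxBr mulmxBl !map_mxM mul_mx_scalar -scalemxAl PI scalemx1.
by rewrite !det_mulmx mulrAC -det_mulmx PI det1 mul1r.
Qed.

(** The weights are the squared moduli of the entries of a unitary matrix diagonalising [A], whose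
    rows and columns are unit vectors. For fixed [i] they form the spectral measure of the basis
    vector e_i. *)
Lemma spectral_weights (N : nat) (A : 'M[R]_N) : (forall i j, A i j = A j i) ->
  exists (lam : 'I_N -> R) (q : 'I_N -> 'I_N -> R),
  [/\ forall i j, 0 <= q i j, forall i, \sum_j q i j = 1, forall j, \sum_i q i j = 1,
      forall k i, (A ^+ k) i i = \sum_j q i j * lam j ^+ k &
      forall F : R[i] -> R[i], \sum_(z <- eigs A) F z = \sum_j F (lam j)%:C].
Proof.
move=> Asym.
pose B := map_mx (fun x : R => x%:C) A : 'M[R[i]]_N.
have Bherm : B \is hermsymmx.
  apply: realsym_hermsym.
    by apply/is_hermitianmxP; rewrite expr0 scale1r; apply/matrixP => i j; rewrite !mxE Asym.
  by apply/mxOverP => i j; rewrite mxE complex_real.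
have Breal := hermitian_spectral_diag_real Bherm.
have BE := orthomx_spectralP (hermitian_normalmx Bherm).
set P := spectralmx B in BE; set sp := spectral_diag B in BE.
have Pu : P \is unitarymx := spectral_unitarymx B.
pose lam j := complex.Re (sp 0 j).
have spE j : sp 0 j = (lam j)%:C.
  by move/mxOverP: Breal => /(_ 0 j) /complex_realP[x]; rewrite /lam /sp => ->.
pose q i j : R := complex.Re (P j i) ^+ 2 + complex.Im (P j i) ^+ 2.
have qE i j : (q i j)%:C = P j i * (P j i)^*.
  by rewrite /q add_Re2_Im2 normCK.
have inj : injective (fun x : R => x%:C) by move=> x y [].
have PP : P *m (P ^t*)%sesqui = 1%:M by exact/unitarymxP.
have PP' : (P ^t*)%sesqui *m P = 1%:M by exact: mulmx1C.
have PI : invmx P = (P ^t*)%sesqui by exact: invmx_unitary.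
have Bk k : B ^+ k = invmx P *m diag_mx (\row_j sp 0 j ^+ k) *m P.
  elim: k => [|k IH].
    rewrite expr0 (_ : \row_j _ = const_mx 1); last by apply/rowP => j; rewrite !mxE.
    by rewrite diag_const_mx mulmx1 mulVmx// unitarymx_unit.
  rewrite exprS IH {1}BE -[_ * _]/(_ *m _) -!mulmxA (mulmxA P) mulmxV ?unitarymx_unit//.
  rewrite mul1mx !mulmxA -(mulmxA _ (diag_mx _) (diag_mx _)) mulmx_diag.
  by congr (_ *m diag_mx _ *m _); apply/rowP => j; rewrite !mxE exprS.
have BA k : B ^+ k = map_mx (real_complex R) (A ^+ k).
  elim: k => [|k IH]; first by rewrite !expr0 map_mx1.
  rewrite !exprS IH -[A * _]/(A *m _) (map_mxM (real_complex R)).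
  by congr (_ *m _); apply/matrixP => i j; rewrite !mxE.
exists lam, q; split.
- by move=> i j; rewrite addr_ge0// sqr_ge0.
- move=> i; apply: inj; rewrite /= rmorph_sum /=.
  move/matrixP: PP' => /(_ i i); rewrite !mxE eqxx => e; rewrite -[RHS]e; apply: eq_bigr => j _.
  by rewrite qE !mxE mulrC.
- move=> j; apply: inj; rewrite /= rmorph_sum /=.
  move/matrixP: PP => /(_ j j); rewrite !mxE eqxx => e; rewrite -[RHS]e; apply: eq_bigr => i _.
  by rewrite qE !mxE.
- move=> k i; apply: inj; rewrite /= rmorph_sum /=.
  have -> : ((A ^+ k) i i)%:C = (B ^+ k) i i.
    by rewrite BA mxE.
  rewrite Bk PI mxE; apply: eq_bigr => j _.
  rewrite rmorphM /= rmorphXn /= -spE qE mul_mx_diag !mxE.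
  by rewrite mulrC mulrA.
(* [eigs] is some chosen list of roots; unique factorisation of the characteristic polynomial
   identifies it with the diagonal up to order. *)
move=> F; rewrite (perm_big [seq (lam j)%:C | j <- enum 'I_N]) /=; last first.
  apply: prod_XsubC_eq; rewrite /eigs.
  have ex : [set s : seq R[i] | char_poly B = \prod_(z <- s) ('X - z%:P)]
     [seq (lam j)%:C | j <- enum 'I_N].
    rewrite /= big_map big_enum /= BE char_poly_conj ?unitarymx_unit//.
    rewrite char_poly_trig; last by apply: diag_mx_is_trig.
    by apply: eq_bigr => j _; rewrite -spE mxE eqxx mulr1n.
  by rewrite -[RHS]ex; apply/esym; exact: (xgetPex [::] (ex_intro _ _ ex)).
by rewrite big_map big_enum.
Qed.
End spectral_weights.

(** * Comparison of measures by moments *)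

Section bernstein.
Variable R : realType.

(* [bernstein n g] is \sum_k 'C(n, k) g(k) X^k (1 - X)^(n - k), by Pascal's rule. *)
Fixpoint bernstein (n : nat) (g : nat -> R) : {poly R} :=
  if n is n'.+1 then (1 - 'X) * bernstein n' g + 'X * bernstein n' (g \o S)
  else (g 0%N)%:P.

Lemma bernsteinS n g x : (bernstein n.+1 g).[x] =
  (1 - x) * (bernstein n g).[x] + x * (bernstein n (g \o S)).[x].
Proof. by rewrite /= !hornerE. Qed.

(** The factor of [K] is the second moment about [b] of the binomial law with parameters n and x, as
    in Chebyshev's inequality. [b] is left free because passing to [f \o S] replaces it by
    [b - 1]. *)
Lemma bernstein_dist (n : nat) (f : nat -> R) (c e K b x : R) : 0 <= x <= 1 ->
  (forall k : nat, `|f k - c| <= e + K * (k%:R - b) ^+ 2) ->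
  `|(bernstein n f).[x] - c| <= e + K * (n%:R * (x * (1 - x)) + (n%:R * x - b) ^+ 2).
Proof.
move=> /andP[x0 x1]; elim: n f b => [|n IH] f b fk.
  by rewrite /= hornerC; apply: le_trans (fk 0%N) _; rewrite !mul0r !add0r.
rewrite bernsteinS.
have h1 := IH f b fk.
have /IH h2 : forall k, `|(f \o S) k - c| <= e + K * (k%:R - (b - 1)) ^+ 2.
  by move=> k /=; apply: le_trans (fk k.+1) _; rewrite -natr1 opprB addrA addrAC.
have -> : (1 - x) * (bernstein n f).[x] + x * (bernstein n (f \o S)).[x] - c =
  (1 - x) * ((bernstein n f).[x] - c) + x * ((bernstein n (f \o S)).[x] - c) by ring.
apply: le_trans (ler_normD _ _) _; rewrite !normrM (ger0_norm x0).
rewrite [`|1 - x|]ger0_norm ?subr_ge0//.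
apply: le_trans (lerD (ler_wpM2l _ h1) (ler_wpM2l x0 h2)) _; rewrite ?subr_ge0//.
by rewrite -[n.+1%:R]natr1 le_eqVlt; apply/orP; left; apply/eqP; ring.
Qed.

(** Closer than some [d], uniform continuity on the compact interval gives [e]; farther away, the
    trivial bound 2M is at most 2M/d^2 times the squared distance. *)
Lemma continuous_quadratic_modulus (f : R -> R) (a b M e : R) : continuous f ->
  (forall x, `|f x| <= M) -> 0 < e ->
  exists2 K, 0 <= K & forall x y, a <= x <= b -> `|f y - f x| <= e + K * (y - x) ^+ 2.
Proof.
move=> cf fM e0.
have nc := (@compact_near_coveringP _ _).1 (@segment_compact _ a b).
have : \forall d \near 0^'+, `[a, b] `<=` (fun x => forall y, `|y - x| < d -> `|f y - f x| <= e).
  apply: nc => x _.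
  have /cvgrPdist_lt /(_ (e / 2)) := cf x.
  rewrite divr_gt0// => /(_ isT) /nbhs_ballP[r /= r0 hr].
  have r20 : 0 < r / 2 by rewrite divr_gt0.
  exists (ball x (r / 2), [set d | d < r / 2]).
    by split; [exact: nbhsx_ballx|exact: nbhs_right_lt].
  move=> [z d] /= [xz dr] y yz.
  have hz : `|f x - f z| < e / 2.
    by apply: hr; apply: lt_trans xz _; rewrite ltr_pdivrMr// ltr_pMr// ltr1n.
  have hy : `|f x - f y| < e / 2.
    apply: hr; rewrite /ball /= in xz *.
    rewrite -(subrK z x) -addrA (le_lt_trans (ler_normD _ _))//.
    rewrite distrC in yz; rewrite [ltRHS](splitr r) ltrD// (lt_trans yz)//.
  rewrite -(subrK (f x) (f y)) -addrA (le_trans (ler_normD _ _))//.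
  by rewrite [leRHS](splitr e) lerD// ltW// distrC.
move=> hd; have [d [d0 {}hd]] := filter_ex (filterI (nbhs_right_gt 0) hd).
have M0 : 0 <= M by apply: le_trans (fM 0).
exists (2 * M / d ^+ 2); first by rewrite divr_ge0 ?sqr_ge0// mulr_ge0.
move=> x y xab; have [yx|yx] := ltP `|y - x| d.
  have /= := hd x; rewrite in_itv /= => /(_ xab y yx) /le_trans; apply.
  by rewrite lerDl mulr_ge0 ?sqr_ge0// divr_ge0 ?sqr_ge0// mulr_ge0.
apply: (@le_trans _ _ (2 * M)).
  by rewrite (le_trans (ler_normB _ _))// mulrDl mul1r lerD.
rewrite -[leLHS]add0r lerD ?(ltW e0)//.
rewrite mulrAC ler_pdivlMr ?exprn_gt0// ler_wpM2l ?mulr_ge0//.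
by rewrite -(real_normK (num_real (y - x))) lerXn2r// nnegrE ltW.
Qed.

Lemma weierstrass (f : R -> R) (M B e : R) : continuous f -> (forall x, `|f x| <= M) ->
  0 < B -> 0 < e ->
  exists P : {poly R}, forall x, `|x| <= B -> `|f x - P.[x]| <= e.
Proof.
move=> cf fM B0 e0.
have e20 : 0 < e / 2 by rewrite divr_gt0.
have [K K0 hK] := continuous_quadratic_modulus (- B) B cf fM e20.
(* Since t(1-t) is at most 1/4, the variance term will be at most K B^2/(n+1), which this choice
   makes smaller than e/2. *)
have [n nK] : exists n : nat, 2 * K * B ^+ 2 / e <= n%:R.
  exists (Num.bound (2 * K * B ^+ 2 / e)).
  by apply/ltW/archi_boundP; rewrite divr_ge0 ?(ltW e0)// !mulr_ge0// ?(ltW B0).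
pose node (k : nat) := - B + 2 * B * k%:R / n.+1%:R.
pose P := bernstein n.+1 (f \o node) \Po ((2 * B)^-1 *: 'X + 2^-1%:P).
exists P => x xB; rewrite /P horner_comp distrC.
set t := (X in (bernstein _ _).[X]).
have xt : x = - B + 2 * B * t by rewrite /t !hornerE; field; lra.
have BB : - B <= x <= B by rewrite -ler_norml.
have t01 : 0 <= t <= 1.
  have B20 : 0 < 2 * B by rewrite mulr_gt0.
  move: BB; rewrite xt => /andP[b1 b2].
  apply/andP; split; first by rewrite -(pmulr_rge0 _ B20); lra.
  by rewrite -(ler_pM2l B20); lra.
have n0 : 0 < n.+1%:R :> R by [].
pose K' := K * (2 * B / n.+1%:R) ^+ 2.
apply: le_trans (@bernstein_dist n.+1 (f \o node) (f x) (e / 2) K' (n.+1%:R * t) t t01 _) _.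
  move=> k; apply: le_trans (hK x (node k) BB) _.
  rewrite lerD2l /K' -[leRHS]mulrA ler_wpM2l// -exprMn.
  rewrite {1}xt /node le_eqVlt; apply/orP; left; apply/eqP; congr (_ ^+ 2); field.
  by rewrite nat1r pnatr_eq0.
rewrite [leRHS](splitr e) lerD2l subrr expr0n addr0 /K'.
have -> : K * (2 * B / n.+1%:R) ^+ 2 * (n.+1%:R * (t * (1 - t))) =
   K * B ^+ 2 * (4 * (t * (1 - t))) / n.+1%:R.
  by field; rewrite nat1r pnatr_eq0.
rewrite ler_pdivrMr//.
have KB : 0 <= K * B ^+ 2 by rewrite mulr_ge0// sqr_ge0.
have t1 : 4 * (t * (1 - t)) <= 1 by have := sqr_ge0 (2 * t - 1); lra.
have : K * B ^+ 2 * (4 * (t * (1 - t))) <= K * B ^+ 2 by rewrite ler_piMr.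
move: nK; rewrite ler_pdivrMr// -[n.+1%:R]natr1 => nK.
by lra.
Qed.

(* Only [beta] is known to live on [[-B, B]]; beyond [2 B], the high even moments of [alpha], which
   are close to those of [beta], leave little mass, even against a polynomial of fixed degree. *)
Lemma moment_comparison (F : R -> R) (M B e : R) : continuous F -> (forall x, `|F x| <= M) ->
  1 <= B -> 0 < e ->
  exists K : nat, exists2 eta : R, 0 < eta &
  forall (I J : finType) (alpha : I -> R) (lam : I -> R) (beta : J -> R) (kap : J -> R),
    (forall i, 0 <= alpha i) -> \sum_i alpha i = 1 ->
    (forall j, 0 <= beta j) -> \sum_j beta j = 1 ->
    (forall j, `|kap j| <= B) ->
    (forall k, (k <= K)%N ->
      `|\sum_i alpha i * lam i ^+ k - \sum_j beta j * kap j ^+ k| <= eta) ->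
    `|\sum_i alpha i * F (lam i) - \sum_j beta j * F (kap j)| <= e.
Proof.
move=> cF FM B1 e0.
have B0 : 0 < B by exact: lt_le_trans B1.
have B2 : 1 <= 2 * B by lra.
have e8 : 0 < e / 8 by lra.
have [P hP] := weierstrass cF FM (ltac:(lra) : 0 < 2 * B) e8.
pose S := \sum_(i < size P) `|P`_i|.
have S0 : 0 <= S by exact: sumr_ge0.
have M0 : 0 <= M by exact: le_trans (FM 0).
(* Beyond 2B, |F - P| is at most (M+S)|x|^(size P), hence at most C (|x|/2B)^(2k) as soon as 2k is
   at least [size P]. *)
pose C := (M + S) * (2 * B) ^+ size P.
have C0 : 0 <= C by rewrite mulr_ge0 ?addr_ge0// exprn_ge0// (le_trans _ B2).
have [k0 hk0] : exists k0 : nat, 2 * C / (e / 8) <= k0%:R.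
  exists (Num.bound (2 * C / (e / 8))).
  by apply/ltW/archi_boundP; rewrite divr_ge0 ?(ltW e8)// mulr_ge0.
pose k := maxn k0 (size P).
have kP : (size P <= k.*2)%N.
  by rewrite (leq_trans (leq_maxr k0 _))// -addnn leq_addr.
(* The 2k-th moment of [alpha] will be at most 2 B^(2k), so the tail costs at most 2C
   B^(2k)/(2B)^(2k) = 2C/4^k. *)
have kC : 2 * C / 4 ^+ k <= e / 8.
  have k4 : k%:R <= 4 ^+ k :> R by rewrite -natrX ler_nat ltnW// ltn_expl.
  rewrite ler_pdivrMr ?exprn_gt0// [leRHS]mulrC -ler_pdivrMr//.
  by rewrite (le_trans hk0)// (le_trans _ k4)// ler_nat leq_maxl.
(* The bound 1 keeps the 2k-th moment of [alpha] under B^(2k) + 1, at most 2 B^(2k) as B is at least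
   1; the other bound controls the difference of the integrals of [P], whose coefficients sum to [S]
   in absolute value. *)
exists k.*2, (Num.min 1 (e / 8 / (S + 1))).
  by rewrite lt_min ltr01 divr_gt0// ltr_wpDl.
move=> I J alpha lam beta kap a0 a1 b0 b1 kB hmom.
set eta := Num.min _ _ in hmom.
have eta1 : eta <= 1 by rewrite ge_min lexx.
have etaS : S * eta <= e / 8.
  have : eta <= e / 8 / (S + 1) by rewrite ge_min lexx orbT.
  rewrite ler_pdivlMr ?ltr_wpDl// => h.
  have : 0 <= eta by rewrite le_min ler01 divr_ge0// ?(ltW e8)// addr_ge0.
  by lra.
have FP x : `|F x - P.[x]| <= e / 8 + C / (2 * B) ^+ k.*2 * x ^+ k.*2.
  have xk : 0 <= x ^+ k.*2 by rewrite exprn_even_ge0// odd_double.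
  have Bk : 0 < (2 * B) ^+ k.*2 by rewrite exprn_gt0// (lt_le_trans _ B2).
  have [xB|xB] := leP `|x| (2 * B).
    rewrite (le_trans (hP x xB))// lerDl mulr_ge0// divr_ge0// ltW//.
  have x1 : 1 <= `|x| by rewrite (le_trans B2)// ltW.
  apply: (@le_trans _ _ ((M + S) * `|x| ^+ size P)).
    rewrite (le_trans (ler_normB _ _))// mulrDl lerD//.
      by rewrite (le_trans (FM x))// ler_peMr// exprn_ege1.
    rewrite horner_coef (le_trans (ler_norm_sum _ _ _))// mulr_suml ler_sum// => i _.
    by rewrite normrM normrX ler_wpM2l// ler_weXn2l// ltnW.
  rewrite -[leLHS]add0r lerD ?(ltW e8)//.
  rewrite [leRHS]mulrAC ler_pdivlMr// /C.
  have -> : x ^+ k.*2 = `|x| ^+ k.*2 by rewrite -normrX ger0_norm.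
  rewrite -(subnK kP) !exprD; set q := (_ - _)%N.
  have u0 : 0 <= 2 * B by rewrite (le_trans _ B2).
  rewrite [leLHS](_ : _ = (M + S) * (2 * B) ^+ size P * `|x| ^+ size P * (2 * B) ^+ q).
    rewrite [leRHS](_ : _ = (M + S) * (2 * B) ^+ size P * `|x| ^+ size P * `|x| ^+ q).
      rewrite ler_wpM2l//; last by rewrite lerXn2r ?nnegrE// ltW.
      by rewrite !mulr_ge0 ?addr_ge0 ?exprn_ge0.
    by ring.
  by ring.
have momE (T : finType) (g l : T -> R) : \sum_i g i * P.[l i] =
    \sum_(j < size P) P`_j * \sum_i g i * l i ^+ j.
  under eq_bigr do rewrite horner_coef mulr_sumr.
  rewrite exchange_big /=; apply: eq_bigr => j _; rewrite mulr_sumr.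
  by apply: eq_bigr => i _; rewrite mulrCA.
have -> : \sum_i alpha i * F (lam i) - \sum_j beta j * F (kap j) =
  \sum_i alpha i * (F (lam i) - P.[lam i]) +
  (\sum_i alpha i * P.[lam i] - \sum_j beta j * P.[kap j]) -
  \sum_j beta j * (F (kap j) - P.[kap j]).
  under [X in _ = X + _ - _]eq_bigr do rewrite mulrBr.
  under [X in _ = _ + _ - X]eq_bigr do rewrite mulrBr.
  by rewrite !sumrB; ring.
have h1 : `|\sum_i alpha i * (F (lam i) - P.[lam i])| <= e / 8 + e / 8.
  rewrite (le_trans (ler_norm_sum _ _ _))//.
  apply: (@le_trans _ _ (\sum_i (alpha i * (e / 8) +
     C / (2 * B) ^+ k.*2 * (alpha i * lam i ^+ k.*2)))).
    apply: ler_sum => i _; rewrite normrM ger0_norm// [X in _ <= _ + X]mulrCA -mulrDr.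
    by rewrite ler_wpM2l.
  rewrite big_split /= -mulr_suml a1 mul1r lerD2l -mulr_sumr.
  have mb : \sum_j beta j * kap j ^+ k.*2 <= B ^+ k.*2.
    rewrite -[leRHS]mul1r -b1 mulr_suml ler_sum// => j _; rewrite ler_wpM2l//.
    by rewrite (le_trans (ler_norm _))// normrX lerXn2r// nnegrE// ltW.
  have ma : \sum_i alpha i * lam i ^+ k.*2 <= B ^+ k.*2 * 2.
    have := hmom k.*2 (leqnn _); rewrite ler_norml => /andP[_].
    have : 1 <= B ^+ k.*2 by rewrite exprn_ege1.
    by lra.
  apply: le_trans (ler_wpM2l _ ma) _.
    by rewrite divr_ge0// exprn_ge0// (le_trans _ B2).
  apply: le_trans kC; rewrite exprMn -mul2n !exprM.
  have -> : (2 : R) ^+ 2 = 4 by ring.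
  rewrite le_eqVlt; apply/orP; left; apply/eqP; field.
  by rewrite !expf_neq0// gt_eqF.
have h2 : `|\sum_i alpha i * P.[lam i] - \sum_j beta j * P.[kap j]| <= e / 8.
  rewrite !momE -sumrB (le_trans (ler_norm_sum _ _ _))// (le_trans _ etaS)// mulr_suml.
  apply: ler_sum => i _; rewrite -mulrBr normrM ler_wpM2l// hmom//.
  by rewrite (leq_trans (ltnW (ltn_ord i))).
have h3 : `|\sum_j beta j * (F (kap j) - P.[kap j])| <= e / 8.
  rewrite (le_trans (ler_norm_sum _ _ _))//.
  have -> : e / 8 = \sum_j beta j * (e / 8) by rewrite -mulr_suml b1 mul1r.
  apply: ler_sum => j _; rewrite normrM ger0_norm// ler_wpM2l// hP// (le_trans (kB j))//; lra.
rewrite (le_trans (ler_normB _ _))//.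
have := ler_normD (\sum_i alpha i * (F (lam i) - P.[lam i]))
  (\sum_i alpha i * P.[lam i] - \sum_j beta j * P.[kap j]).
by lra.
Qed.
End bernstein.

(** * Fourier coefficients of the symbol *)

Section steps.
Variables (R : realType) (d m : nat) (t : 'I_m -> 'I_d -> nat) (w : {ffun 'I_d -> int} -> R).
Hypothesis t_pos : forall k : 'I_m, lexlt (fun _ => 0%N) (t k).
Hypothesis t_incr : forall k1 k2 : 'I_m, (k1 < k2)%N -> lexlt (t k1) (t k2).

(** Flipping the sign of a zero coordinate yields the same vector, whence [undup]. *)
Definition signed_vecs (k : 'I_m) : seq {ffun 'I_d -> int} :=
  undup [seq signed_vec (t k) s | s <- enum {ffun 'I_d -> bool}].

Definition steps : seq {ffun 'I_d -> int} := flatten [seq signed_vecs k | k <- enum 'I_m].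

Lemma mem_signed_vecs k u : (u \in signed_vecs k) = [forall r, absz (u r) == t k r].
Proof.
rewrite mem_undup; apply/mapP/forallP => [[s _ ->] r|h].
  by rewrite ffunE; case: ifP => _; rewrite ?abszN absz_nat.
exists [ffun r => u r < 0]; first by rewrite mem_enum.
apply/ffunP => r; rewrite !ffunE -(eqP (h r)); case: ltP => ur.
  by rewrite ltz0_abs// opprK.
by rewrite gez0_abs.
Qed.

Lemma mem_steps u :
  (u \in steps) = [exists k : 'I_m, [forall r : 'I_d, absz (u r) == t k r]].
Proof.
apply/flatten_mapP/existsP => [[k _ uk]|[k uk]]; exists k; rewrite ?mem_enum//.
  by rewrite -mem_signed_vecs.
by rewrite mem_signed_vecs.
Qed.

Lemma lexlt_neq (a b : 'I_d -> nat) : lexlt a b -> exists r, a r != b r.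
Proof. by move=> [r [ab _]]; exists r; rewrite ltn_eqF. Qed.

(** The absolute values of a step recover [t k], and the [t k] are pairwise different because they
    increase strictly. *)
Lemma steps_uniq : uniq steps.
Proof.
rewrite /steps; have : uniq (enum 'I_m) by exact: enum_uniq.
elim: (enum 'I_m) => //= k s IH /andP[ks us]; rewrite cat_uniq undup_uniq IH// andbT /=.
apply/hasPn => u /flatten_mapP[k' k's]; rewrite !mem_signed_vecs => /forallP h'.
apply/negP => /forallP h.
have [r] : exists r, t k r != t k' r.
  have [kk|kk|kk] := ltngtP k k'; first exact/lexlt_neq/t_incr.
    by have [r rr] := lexlt_neq (t_incr kk); exists r; rewrite eq_sym.
  by move/val_inj: kk => kk; move: ks; rewrite kk k's.
by rewrite -(eqP (h r)) (eqP (h' r)) eqxx.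
Qed.

(** As [t k] is nonzero, [u] has a first nonzero coordinate, and its sign alone decides [posrep]. *)
Lemma posrepN (u : {ffun 'I_d -> int}) k : u \in signed_vecs k -> posrep (- u) = ~~ posrep u.
Proof.
rewrite mem_signed_vecs => /forallP uk.
have [r0 [r0P _]] := t_pos k.
have ex : exists n, [exists r : 'I_d, (r == n :> nat) && (u r != 0)].
  exists r0; apply/existsP; exists r0; rewrite eqxx -absz_eq0 (eqP (uk r0)) /=.
  by rewrite -lt0n.
case: (ex_minnP ex) => n /existsP[r /andP[/eqP rn ur]] nmin.
have umin (r' : 'I_d) : (r' < r)%N -> u r' = 0.
  move=> rr; apply/eqP; apply: contraTT rr => ur'; rewrite -leqNgt rn; apply: nmin.
  by apply/existsP; exists r'; rewrite eqxx.
have posE (x : {ffun 'I_d -> int}) : (forall r' : 'I_d, (r' < r)%N -> x r' = 0) -> x r != 0 ->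
    posrep x = (0 < x r).
  move=> x0 xr; apply/existsP/idP => [[q /andP[q0 /forallP hq]]|xr0]; last first.
    by exists r; rewrite xr0; apply/forallP => r'; apply/implyP => /x0 ->.
  have [qr|qr|/val_inj <-//] := ltngtP q r; first by rewrite x0 in q0.
  by have := hq r; rewrite qr /= (negbTE xr).
rewrite (posE u)// posE ?ffunE ?oppr_eq0//; last first.
  by move=> r' /umin; rewrite ffunE => ->; rewrite oppr0.
by rewrite oppr_gt0 -leNgt le_eqVlt (negbTE ur).
Qed.

Lemma canonN u : u \in steps -> Defs.canon (- u) = Defs.canon u.
Proof.
move=> /flatten_mapP[k _ uk]; rewrite /Defs.canon (posrepN uk).
case: posrep => //=; apply/ffunP => r; rewrite !ffunE ?opprK//.
Qed.

Lemma stepsN u : (- u \in steps) = (u \in steps).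
Proof.
by rewrite !mem_steps; apply: eq_existsb => k; apply: eq_forallb => r; rewrite ffunE abszN.
Qed.

Lemma sum_stepsN (g : {ffun 'I_d -> int} -> R) :
  \sum_(u <- steps) g (- u) = \sum_(u <- steps) g u.
Proof.
rewrite [RHS](perm_big (map -%R steps)) /=; first by rewrite big_map.
have inj := @oppr_inj {ffun 'I_d -> int}.
apply: uniq_perm; first exact: steps_uniq; first by rewrite (map_inj_uniq inj) steps_uniq.
by move=> u; rewrite -[in RHS](opprK u) (mem_map inj) stepsN.
Qed.

Definition step_weight (u : {ffun 'I_d -> int}) : R := w (Defs.canon u).

Lemma dotZN u (th : 'I_d -> R) : dotZ (- u) th = - dotZ u th.
Proof. by rewrite /dotZ -sumrN; apply: eq_bigr => r _; rewrite ffunE mulrNz mulNr. Qed.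

Lemma dotZB u v (th : 'I_d -> R) : dotZ (u - v) th = dotZ u th - dotZ v th.
Proof.
by rewrite /dotZ -sumrB; apply: eq_bigr => r _; rewrite !ffunE mulrzBr mulrBl.
Qed.

(** The factor 2 in [symbol] is shared between [u] and [- u], which have the same cosine and the
    same weight. *)
Lemma symbolE th : symbol t w th = \sum_(u <- steps) step_weight u * cos (dotZ u th).
Proof.
rewrite /symbol /steps big_flatten /= big_map big_enum; apply: eq_bigr => k _.
rewrite big_filter -/(signed_vecs k).
rewrite [RHS](bigID (@posrep d)) /=.
have -> : \sum_(u <- signed_vecs k | ~~ posrep u) step_weight u * cos (dotZ u th) =
   \sum_(u <- signed_vecs k | posrep u) step_weight u * cos (dotZ u th).
  rewrite (perm_big (map -%R (signed_vecs k))) /=; last first.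
    have inj := @oppr_inj {ffun 'I_d -> int}.
    apply: uniq_perm; first exact: undup_uniq; first by rewrite (map_inj_uniq inj) undup_uniq.
    move=> u; rewrite -[in RHS](opprK u) (mem_map inj).
    by rewrite !mem_signed_vecs; apply: eq_forallb => r; rewrite ffunE abszN.
  rewrite big_map big_seq_cond [RHS]big_seq_cond; apply: eq_big => u.
    by case uk : (u \in signed_vecs k); rewrite //= (posrepN uk) negbK.
  move=> /andP[uk _]; rewrite dotZN cosN /step_weight canonN//.
  by apply/flatten_mapP; exists k; rewrite ?mem_enum.
rewrite -big_split /=; apply: eq_bigr => u pu.
by rewrite /step_weight /Defs.canon pu; ring.
Qed.

(** Convolution in real form: the coefficients are even, so the sine terms of the addition formula
    cancel. *)
Lemma symbol_mul_cos v th :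
  symbol t w th * cos (dotZ v th) = \sum_(u <- steps) step_weight u * cos (dotZ (v - u) th).
Proof.
have odd0 : \sum_(u <- steps) step_weight u * sin (dotZ u th) = 0.
  set s := LHS; suff : s = - s by lra.
  rewrite {1}/s -sum_stepsN -sumrN big_seq [RHS]big_seq; apply: eq_bigr => u us.
  by rewrite /step_weight canonN// dotZN sinN mulrN.
transitivity (symbol t w th * cos (dotZ v th) +
    sin (dotZ v th) * \sum_(u <- steps) step_weight u * sin (dotZ u th)).
  by rewrite odd0 mulr0 addr0.
rewrite symbolE mulr_suml mulr_sumr -big_split /=.
by apply: eq_bigr => u _; rewrite dotZB cosB; ring.
Qed.

(* The coefficient of [exp (i v . theta)] in [symbol ^ k]. *)
Fixpoint convpow (k : nat) (v : {ffun 'I_d -> int}) : R :=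
  if k is k'.+1 then \sum_(u <- steps) step_weight u * convpow k' (v - u) else (v == 0)%:R.


Variable T : nat.
Hypothesis tT : forall k r, (t k r <= T)%N.

Lemma steps_bound u r : u \in steps -> (absz (u r) <= T)%N.
Proof. by rewrite mem_steps => /existsP[k /forallP/(_ r)/eqP ->]. Qed.

(* The points [theta l] form the grid of step [2 pi / M] in [(-pi, pi]^d]: averaging over it
   annihilates the nonconstant characters of degree less than [M]. *)
Definition theta (M : nat) (l : {ffun 'I_d -> 'I_M}) (r : 'I_d) : R :=
  - pi + 2 * pi * (l r).+1%:R / M%:R.

Definition cis (x : R) : R[i] := Complex (cos x) (sin x).

Lemma cisD x y : cis (x + y) = cis x * cis y.
Proof. by rewrite /cis cosD sinD; apply/eqP; rewrite eq_complex /= eqxx addrC eqxx. Qed.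

Lemma cis_sum (I : finType) (f : I -> R) : cis (\sum_i f i) = \prod_i cis (f i).
Proof.
have cis0 : cis 0 = 1 by rewrite /cis cos0 sin0.
by apply: (big_morph cis cisD cis0).
Qed.

Lemma cis_mulrn x n : cis (x *+ n) = cis x ^+ n.
Proof.
elim: n => [|n IH]; first by rewrite mulr0n expr0 /cis cos0 sin0.
by rewrite mulrS exprS cisD IH.
Qed.

Lemma cis2pi : cis (2 * pi) = 1.
Proof. by rewrite /cis mulrC mulr_natr cos2pi sin2pi. Qed.

Lemma cis_root (v : int) : cis (2 * pi * v%:~R) = 1.
Proof.
have cisN : cis (- (2 * pi)) = 1.
  by rewrite /cis cosN sinN mulrC mulr_natr cos2pi sin2pi oppr0.
case: v => n; first by rewrite -pmulrn mulr_natr cis_mulrn cis2pi expr1n.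
by rewrite NegzE mulrNz mulrN -mulNr -pmulrn mulr_natr cis_mulrn cisN expr1n.
Qed.

Lemma cis_neq1 x : 0 < `|x| < 2 * pi -> cis x != 1.
Proof.
move=> /andP[x0 x2]; rewrite eq_complex /= negb_and; apply/orP; left.
have -> : cos x = 1 - 2 * sin (`|x| / 2) ^+ 2.
  have -> : cos x = cos `|x| by case: (ger0P x) => _; rewrite ?cosN.
  rewrite {1}(splitr `|x|) cosD -!expr2; have := cos2Dsin2 (`|x| / 2); lra.
have : 0 < sin (`|x| / 2) by apply: sin_gt0_pi; apply/andP; split; lra.
move=> /(exprn_gt0 2) s2; apply/eqP; lra.
Qed.

(** A geometric sum whose ratio is an M-th root of unity, different from 1 because 0 < |v| < M. *)
Lemma sum_cis_root (M : nat) (v : int) : (absz v < M)%N ->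
  \sum_(q < M) cis (v%:~R * (- pi + 2 * pi * q.+1%:R / M%:R)) =
  ((v == 0)%:R * M%:R).
Proof.
move=> vM; have M0 : (0 < M)%N by apply: leq_ltn_trans vM.
have [->|v0] := eqVneq v 0.
  rewrite mul1r (eq_bigr (fun _ => 1)) ?sumr_const ?card_ord// => q _.
  by rewrite mul0r /cis cos0 sin0.
rewrite mul0r.
have MR : M%:R != 0 :> R by rewrite pnatr_eq0 -lt0n.
set x : R := 2 * pi * v%:~R / M%:R.
have qE (q : 'I_M) : cis (v%:~R * (- pi + 2 * pi * q.+1%:R / M%:R)) =
   cis (- pi * v%:~R + x) * cis x ^+ q.
  rewrite -cis_mulrn -cisD; congr cis; rewrite /x -mulr_natr -[q.+1%:R]natr1; field.
  exact: MR.
under eq_bigr do rewrite qE.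
rewrite -mulr_sumr.
have x1 : cis x != 1.
  apply: cis_neq1; have pi0 := pi_gt0 R.
  rewrite normr_gt0 /x !normrM normfV (ger0_norm (ler0n _ M)) (gtr0_norm pi0).
  rewrite (ger0_norm (ler0n _ 2)) ltr_pdivrMr ?ltr0n// ltr_pM2l ?mulr_gt0//.
  rewrite -intr_norm -abszE ltr_nat vM andbT.
  by rewrite !mulf_neq0 ?invr_eq0 ?intr_eq0 ?(gt_eqF pi0)// pnatr_eq0.
have : (cis x - 1) * \sum_(q < M) cis x ^+ q = 0.
  rewrite -subrX1 -cis_mulrn (_ : x *+ M = 2 * pi * v%:~R); last first.
    by rewrite -(mulr_natr x M) /x divfK.
  by rewrite cis_root subrr.
by move=> /eqP; rewrite mulf_eq0 subr_eq0 (negbTE x1) /= => /eqP ->; rewrite mulr0.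
Qed.

Lemma sum_cos_theta (M : nat) (v : {ffun 'I_d -> int}) : (forall r, (absz (v r) < M)%N) ->
  \sum_(l : {ffun 'I_d -> 'I_M}) cos (dotZ v (theta l)) = (v == 0)%:R * M%:R ^+ d.
Proof.
move=> vM.
have : \sum_(l : {ffun 'I_d -> 'I_M}) cis (dotZ v (theta l)) = (v == 0)%:R * M%:R ^+ d.
  under eq_bigr do rewrite /dotZ cis_sum.
  rewrite -(bigA_distr_bigA (fun r q => cis ((v r)%:~R * (- pi + 2 * pi * (q : 'I_M).+1%:R / M%:R)))).
  under eq_bigr do rewrite sum_cis_root//.
  rewrite big_split /= prodr_const card_ord; congr (_ * _).
  have [->|v0] := eqVneq v 0; first by rewrite big1// => r _; rewrite ffunE eqxx.
  have [r vr] : exists r, v r != 0.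
    by apply/existsP; apply: contraR v0 => /existsPn h; apply/eqP/ffunP => r; rewrite ffunE;
      apply/eqP; have := h r; rewrite negbK.
  by rewrite (bigD1 r)//= (negbTE vr) mul0r.
move=> /(congr1 (@complex.Re R)).
rewrite (raddf_sum (@complex.Re R)) /= => ->.
have ReN n : complex.Re (n%:R : R[i]) = n%:R.
  by elim: n => // n IH; rewrite -!natr1 raddfD /= IH.
by rewrite -!natrX -!natrM ReN.
Qed.

(** Each factor of the symbol shifts the frequency by at most [T] per coordinate. A grid finer than
    all frequencies that can occur sees no aliasing, so the average is exact. *)
Lemma avg_symbol_pow (M k : nat) (v : {ffun 'I_d -> int}) :
  (forall r, (absz (v r) + k * T < M)%N) -> (0 < M)%N ->
  (M%:R ^+ d)^-1 * \sum_(l : {ffun 'I_d -> 'I_M}) symbol t w (theta l) ^+ k * cos (dotZ v (theta l))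
  = convpow k v.
Proof.
move=> + M0; elim: k v => [|k IH] v vM.
  under eq_bigr do rewrite expr0 mul1r.
  rewrite sum_cos_theta; last by move=> r; have := vM r; rewrite mul0n addn0.
  by rewrite mulrC mulfK// expf_neq0// pnatr_eq0 -lt0n.
rewrite /=.
have -> : \sum_(l : {ffun 'I_d -> 'I_M}) symbol t w (theta l) ^+ k.+1 * cos (dotZ v (theta l)) =
  \sum_(u <- steps) step_weight u *
   \sum_(l : {ffun 'I_d -> 'I_M}) symbol t w (theta l) ^+ k * cos (dotZ (v - u) (theta l)).
  under [RHS]eq_bigr do rewrite mulr_sumr.
  rewrite exchange_big /=; apply: eq_bigr => l _.
  rewrite exprSr -mulrA symbol_mul_cos mulr_sumr; apply: eq_bigr => u _.
  by rewrite mulrCA.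
rewrite mulr_sumr big_seq [RHS]big_seq; apply: eq_bigr => u us.
rewrite mulrCA IH// => r; apply: leq_ltn_trans (vM r).
rewrite !ffunE mulSn addnA leq_add2r.
move: (v r) (u r) (steps_bound r us) => x y yT.
rewrite (leq_trans (leqD_dist x 0 y))// subr0 sub0r abszN leq_add2l//.
Qed.

End steps.

(** * Local limits of the powers of the adjacency matrix *)

Section local_limit.
Variables (R : realType) (d m : nat) (t : 'I_m -> 'I_d -> nat) (w : {ffun 'I_d -> int} -> R).
Hypothesis t_pos : forall k : 'I_m, lexlt (fun _ => 0%N) (t k).
Hypothesis t_incr : forall k1 k2 : 'I_m, (k1 < k2)%N -> lexlt (t k1) (t k2).
Variables (Om : set ('I_d -> R)) (p : ('I_d -> R) -> R).

Definition idx_diff (n : 'I_d -> nat) (i j : Idx n) : {ffun 'I_d -> int} :=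
  [ffun r => (val (i r))%:Z - (val (j r))%:Z].

Lemma toeplitz_weightE n (i j : Idx n) : toeplitz_weight t w i j =
  \sum_(u <- steps t) (u == idx_diff i j)%:R * step_weight w u.
Proof.
rewrite /toeplitz_weight -/(idx_diff i j) -mem_steps.
case: ifPn => h; last first.
  rewrite big_seq big1// => u us; case: eqP => [e|]; last by rewrite mul0r.
  by rewrite -e us in h.
rewrite (bigD1_seq (idx_diff i j)) ?steps_uniq//= eqxx mul1r big1 ?addr0// => u.
by move/negbTE => ->; rewrite mul0r.
Qed.

Lemma WmatC n a b : Wmat t w Om p n a b = Wmat t w Om p n b a.
Proof.
rewrite !mxE /grid_weight; congr (p _ * _).
  by apply/funext => r; rewrite addrC.
rewrite !toeplitz_weightE -(sum_stepsN t_incr) big_seq [RHS]big_seq; apply: eq_bigr => u us.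
rewrite /step_weight (canonN t_pos us) eqr_oppLR.
have -> // : - idx_diff (enum_val a) (enum_val b) = idx_diff (enum_val b) (enum_val a).
by apply/ffunP => r; rewrite !ffunE opprB.
Qed.

Variable n : 'I_d -> nat.
Let N := #|nodes Om n|.
Let A : 'M[R]_N := Wmat t w Om p n.

(* This sum has at most one term, and is [0] when the shifted index is not a
   node, so that no default node has to be chosen. *)
Definition shifted_entry (k : nat) (b : 'I_N) (v : {ffun 'I_d -> int}) : R :=
  \sum_(a : 'I_N | idx_diff (enum_val a) (enum_val b) == v) (A ^+ k) a b.

(** The grid point with index [b + v], computed in the integers so that it makes sense even when
    [b + v] leaves the grid. *)
Definition shifted_pt (b : Idx n) (v : {ffun 'I_d -> int}) (r : 'I_d) : R :=
  ((val (b r)).+1%:Z + v r)%:~R / (n r).+1%:R.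

Lemma idx_diff_inj (b i j : Idx n) : idx_diff i b = idx_diff j b -> i = j.
Proof.
move=> /ffunP h; apply/ffunP => r; apply/val_inj; have := h r; rewrite !ffunE.
by move/addIr => [].
Qed.

Lemma shifted_entry0 b v : shifted_entry 0 b v = (v == 0)%:R.
Proof.
rewrite /shifted_entry expr0.
have diff0 (a : 'I_N) : (idx_diff (enum_val a) (enum_val b) == 0) = (a == b).
  apply/eqP/eqP => [|->]; last by apply/ffunP => r; rewrite !ffunE subrr.
  move=> h; apply/enum_val_inj; apply: (@idx_diff_inj (enum_val b)); rewrite h.
  by apply/ffunP => r; rewrite !ffunE subrr.
have [->|v0] := eqVneq v 0.
  by under eq_bigl do rewrite diff0; rewrite big_pred1_eq mxE eqxx.
rewrite big1// => a /eqP av; rewrite mxE; case: eqP => // ab.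
by move/eqP: v0; rewrite -av; case; apply/eqP; rewrite diff0 ab.
Qed.

Lemma gridpt_shifted (b j : Idx n) v : idx_diff j b = v -> gridpt R j = shifted_pt b v.
Proof.
move=> <-; apply/funext => r; rewrite /gridpt /shifted_pt ffunE; congr (_ / _).
rewrite (_ : _ + _ = (val (j r)).+1%:Z) ?pmulrn//.
by rewrite !intS; ring.
Qed.

(** One matrix product is expanded along row [b + v]. Only that row must be a node: if [b + v - u]
    is not one, there is no such column and [shifted_entry] is an empty sum. *)
Lemma shifted_entryS k b v : (exists a : 'I_N, idx_diff (enum_val a) (enum_val b) = v) ->
  shifted_entry k.+1 b v = \sum_(u <- steps t) step_weight w u *
   (p (fun r => (shifted_pt (enum_val b) v r + shifted_pt (enum_val b) (v - u) r) / 2) *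
    shifted_entry k b (v - u)).
Proof.
move=> [a av]; rewrite /shifted_entry (bigD1 a) ?av//= big1 ?addr0; last first.
  move=> c /andP[/eqP cv /eqP]; case; apply/enum_val_inj.
  by apply: (@idx_diff_inj (enum_val b)); rewrite av cv.
rewrite exprS -[_ * _]/(_ *m _) mxE.
have AE c : A a c = grid_weight t w p (enum_val a) (enum_val c) by rewrite /A mxE.
transitivity (\sum_c \sum_(u <- steps t)
   p (fun r => (gridpt R (enum_val a) r + gridpt R (enum_val c) r) / 2) *
   ((u == idx_diff (enum_val a) (enum_val c))%:R * step_weight w u) * (A ^+ k) c b).
  apply: eq_bigr => c _; rewrite -mulr_suml; congr (_ * _).
  by rewrite -mulr_sumr -toeplitz_weightE; exact: AE.
rewrite exchange_big /=; apply: eq_bigr => u _.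
rewrite !mulr_sumr [RHS]big_mkcond /=; apply: eq_bigr => c _.
have -> : (u == idx_diff (enum_val a) (enum_val c)) =
  (idx_diff (enum_val c) (enum_val b) == v - u).
  rewrite [RHS]eq_sym subr_eq addrC -subr_eq eq_sym -av.
  congr (_ == _); apply/ffunP => r; rewrite !ffunE; ring.
case: eqP => [cE|_]; last by rewrite mul0r mulr0 mul0r.
by rewrite mul1r (gridpt_shifted av) (gridpt_shifted cE); ring.
Qed.

Lemma shifted_node (b : 'I_N) v : (forall r, 0 < shifted_pt (enum_val b) v r < 1) ->
  Om (shifted_pt (enum_val b) v) ->
  exists a : 'I_N, idx_diff (enum_val a) (enum_val b) = v.
Proof.
move=> v01 Omv.
pose z r := (val ((enum_val b : Idx n) r))%:Z + v r.
have zP r : (0 <= z r) && (absz (z r) < n r)%N.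
  have /andP[] := v01 r; rewrite /shifted_pt.
  have n0 : 0 < (n r).+1%:R :> R by rewrite ltr0n.
  rewrite pmulr_lgt0 ?invr_gt0// ltr_pdivrMr// mul1r.
  rewrite ltr0z (_ : (n r).+1%:R = ((n r).+1%:Z)%:~R :> R)// ltr_int /z.
  move: (val _) (v r) => x y h1 h2; apply/andP; split; lia.
have zn r : (absz (z r) < n r)%N by have /andP[] := zP r.
pose j : Idx n := [ffun r => Ordinal (zn r)].
have jv : idx_diff j (enum_val b) = v.
  apply/ffunP => r; rewrite !ffunE /=; have /andP[z0 _] := zP r.
  by rewrite gez0_abs// /z addrAC subrr add0r.
have jN : j \in nodes Om n by rewrite inE; apply/asboolP; rewrite (gridpt_shifted jv).
by exists (enum_rank_in jN j); rewrite enum_rankK_in.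
Qed.

End local_limit.

Lemma cvg_sum_seq (R : realType) (I : Type) (r : seq I) (f : I -> nat -> R) (l : I -> R) :
  (forall i, f i @ \oo --> l i) ->
  (fun s => \sum_(i <- r) f i s) @ \oo --> \sum_(i <- r) l i.
Proof.
move=> fl; elim: r => [|i r IH].
  by rewrite big_nil; under eq_fun do rewrite big_nil; exact: cvg_cst.
by rewrite big_cons; under eq_fun do rewrite big_cons; apply: cvgD.
Qed.

Section node_limit.
Variables (R : realType) (d m : nat) (t : 'I_m -> 'I_d -> nat) (w : {ffun 'I_d -> int} -> R).
Hypothesis t_pos : forall k : 'I_m, lexlt (fun _ => 0%N) (t k).
Hypothesis t_incr : forall k1 k2 : 'I_m, (k1 < k2)%N -> lexlt (t k1) (t k2).
Variables (Om : set ('I_d -> R)) (p : ('I_d -> R) -> R).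
Variables (n : nat -> 'I_d -> nat) (j : forall s, Idx (n s)) (y : 'I_d -> R).
Hypothesis sn : forall s r, (s < n s r)%N.
Hypothesis jy : forall r, (fun s => gridpt R (j s) r) @ \oo --> y r.
Hypothesis y01 : forall r, 0 < y r < 1.
Hypothesis yOm : exists2 del : R, 0 < del & forall z, (forall r, `|z r - y r| < del) -> Om z.
Hypothesis py : forall e : R, 0 < e -> exists2 del : R, 0 < del &
  forall z, Om z -> (forall r, `|z r - y r| < del) -> `|p z - p y| < e.

Lemma near_coord (z : nat -> 'I_d -> R) (del : R) : (forall r, z ^~ r @ \oo --> y r) -> 0 < del ->
  \forall s \near \oo, forall r, `|z s r - y r| < del.
Proof.
move=> zy del0; apply: filter_forall => r.
have /cvgrPdist_lt /(_ _ del0) := zy r.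
by apply: filterS => s; rewrite distrC.
Qed.

Lemma near_Om (z : nat -> 'I_d -> R) : (forall r, z ^~ r @ \oo --> y r) ->
  \forall s \near \oo, Om (z s).
Proof.
move=> zy; have [del del0 h] := yOm.
by apply: filterS (near_coord zy del0) => s; exact: h.
Qed.

Lemma cvg_weight (z : nat -> 'I_d -> R) : (forall r, z ^~ r @ \oo --> y r) ->
  (fun s => p (z s)) @ \oo --> p y.
Proof.
move=> zy; apply/cvgrPdist_lt => e e0; have [del del0 h] := py e0.
near=> s; rewrite distrC; apply: h.
  by near: s; exact: near_Om.
by near: s; exact: near_coord.
Unshelve. all: by end_near. Qed.

Lemma cvg_shifted_pt v r : (fun s => shifted_pt R (j s) v r) @ \oo --> y r.
Proof.
have -> : (fun s => shifted_pt R (j s) v r) =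
  (fun s => gridpt R (j s) r + (v r)%:~R / (n s r).+1%:R).
  by apply/funext => s; rewrite /shifted_pt /gridpt rmorphD /= mulrDl.
rewrite -[y r]addr0; apply: cvgD; first exact: jy.
rewrite -(mulr0 (v r)%:~R); apply: cvgMl_tmp.
have h := @cvg_harmonic R.
apply: (squeeze_cvgr _ (cvg_cst 0) h); apply: nearW => s.
by rewrite invr_ge0 ler0n /= /harmonic lef_pV2 ?posrE ?ltr0n// ler_nat ltnS ltnW.
Qed.

(** Indexed by the grid rather than by the rows of a matrix of varying size, with value 0 off the
    nodes, so that a sequence of grid indices can be followed. *)
Definition node_entry (n : 'I_d -> nat) (k : nat) (i : Idx n) (v : {ffun 'I_d -> int}) : R :=
  \sum_(b : 'I_#|nodes Om n| | enum_val b == i) shifted_entry t w p k b v.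

Let shifted_exists v : \forall s \near \oo, forall b : 'I_#|nodes Om (n s)|,
  enum_val b = j s -> exists a : 'I_#|nodes Om (n s)|, idx_diff (enum_val a) (enum_val b) = v.
Proof.
have [e e0 he] : exists2 e : R, 0 < e & forall r, e <= y r /\ y r <= 1 - e.
  (* The distance from [y] to the faces of the unit cube. *)
  exists (\big[Num.min/1]_r Num.min (y r) (1 - y r)).
    elim/big_ind: _ => // [a b a0 b0|r _]; first by rewrite lt_min a0.
    by have /andP[y0 y1] := y01 r; rewrite lt_min y0 subr_gt0.
  move=> r; have : \big[Num.min/1]_r Num.min (y r) (1 - y r) <= Num.min (y r) (1 - y r).
    exact: bigmin_le.
  by rewrite le_min => /andP[? ?]; split => //; lra.
have h1 := near_Om (cvg_shifted_pt v).
have h2 := near_coord (cvg_shifted_pt v) e0.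
near=> s => b bj; apply: shifted_node; rewrite bj; last by near: s; exact: h1.
have hs : forall r, `|shifted_pt R (j s) v r - y r| < e by near: s; exact: h2.
move=> r; have := hs r; have [] := he r; rewrite ltr_norml => ? ? /andP[? ?].
by apply/andP; split; lra.
Unshelve. all: by end_near. Qed.

Lemma near_node : \forall s \near \oo, j s \in nodes Om (n s).
Proof.
by apply: filterS (near_Om jy) => s sOm; rewrite inE; apply/asboolP.
Qed.

Lemma node_sum (n' : 'I_d -> nat) (i : Idx n') (c : R) : i \in nodes Om n' ->
  \sum_(b : 'I_#|nodes Om n'| | enum_val b == i) c = c.
Proof.
move=> iN; rewrite (big_pred1 (enum_rank_in iN i))// => b.
apply/eqP/eqP => [bi|->]; last by rewrite enum_rankK_in.
by apply/enum_val_inj; rewrite enum_rankK_in.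
Qed.

(** The recursion of [shifted_entry] turns into that of [convpow]: each step brings one value of [p]
    at a midpoint tending to [y], hence one factor [p y]. *)
Lemma cvg_node_entry k v :
  (fun s => node_entry k (j s) v) @ \oo --> p y ^+ k * convpow t w k v.
Proof.
elim: k v => [|k IH] v.
  rewrite expr0 mul1r; apply: cvg_near_cst.
  apply: filterS near_node => s js; rewrite /node_entry.
  by under eq_bigr do rewrite shifted_entry0; rewrite node_sum.
have E : \forall s \near \oo, \sum_(u <- steps t) step_weight w u *
    (p (fun r => (shifted_pt R (j s) v r + shifted_pt R (j s) (v - u) r) / 2) *
     node_entry k (j s) (v - u)) = node_entry k.+1 (j s) v.
  apply: filterS (shifted_exists v) => s hs.
  rewrite /node_entry [RHS](eq_bigr (fun b => \sum_(u <- steps t) step_weight w u *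
    (p (fun r => (shifted_pt R (j s) v r + shifted_pt R (j s) (v - u) r) / 2) *
     shifted_entry t w p k b (v - u)))); last first.
    by move=> b /eqP bj; rewrite shifted_entryS ?bj//; rewrite -bj; exact: hs.
  rewrite exchange_big /=; apply: eq_bigr => u _.
  by rewrite !mulr_sumr.
apply: cvg_trans (near_eq_cvg E) _.
have -> : p y ^+ k.+1 * convpow t w k.+1 v =
  \sum_(u <- steps t) step_weight w u * (p y * (p y ^+ k * convpow t w k (v - u))).
  by rewrite /= mulr_sumr; apply: eq_bigr => u _; rewrite exprS; ring.
apply: cvg_sum_seq => u; apply: cvgMl_tmp; apply: cvgM; last exact: IH.
apply: cvg_weight => r.
rewrite -[y r](mulfK (_ : 2 != 0 :> R))// mulr_natr mulr2n.
by apply: cvgMr_tmp; apply: cvgD; exact: cvg_shifted_pt.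
Qed.

End node_limit.

(** * Local limits of the spectral measures *)

Section local_spectral.
Variables (R : realType) (d m : nat) (t : 'I_m -> 'I_d -> nat) (w : {ffun 'I_d -> int} -> R).
Hypothesis t_pos : forall k : 'I_m, lexlt (fun _ => 0%N) (t k).
Hypothesis t_incr : forall k1 k2 : 'I_m, (k1 < k2)%N -> lexlt (t k1) (t k2).
Variables (Om : set ('I_d -> R)) (p : ('I_d -> R) -> R).

Definition theta_avg (M : nat) (f : ('I_d -> R) -> R) : R :=
  (M%:R ^+ d)^-1 * \sum_(l : {ffun 'I_d -> 'I_M}) f (theta R l).

Lemma theta_avg_norm (M : nat) (f : ('I_d -> R) -> R) (C : R) : (0 < M)%N ->
  (forall th, `|f th| <= C) -> `|theta_avg M f| <= C.
Proof.
move=> M0 fC; have MR : 0 < M%:R ^+ d :> R by rewrite exprn_gt0// ltr0n.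
rewrite /theta_avg normrM normfV (gtr0_norm MR) ler_pdivrMl//.
rewrite (le_trans (ler_norm_sum _ _ _))// (le_trans (ler_sum _ (fun l _ => fC _)))//.
by rewrite sumr_const card_ffun !card_ord -natrX mulr_natl.
Qed.

Lemma symbol_bound : exists2 C : R, 0 < C & forall th, `|symbol t w th| <= C.
Proof.
exists (1 + \sum_(u <- steps t) `|step_weight w u|).
  by rewrite ltr_pwDl// sumr_ge0.
move=> th; rewrite symbolE// (le_trans (ler_norm_sum _ _ _))//.
apply: le_trans (_ : \sum_(u <- steps t) `|step_weight w u| <= _); last by rewrite lerDr.
apply: ler_sum => u _; rewrite normrM ler_piMr//.
by rewrite ler_norml cos_geN1 cos_le1.
Qed.

Variables (n : nat -> 'I_d -> nat) (F : R -> R) (C : R).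
Hypothesis cF : continuous F.
Hypothesis FC : forall x, `|F x| <= C.
Variables (lam : forall s, 'I_#|nodes Om (n s)| -> R)
  (q : forall s, 'I_#|nodes Om (n s)| -> 'I_#|nodes Om (n s)| -> R).
Hypothesis q0 : forall s b a, 0 <= q (s := s) b a.
Hypothesis q1 : forall s b, \sum_a q (s := s) b a = 1.
Hypothesis qlam : forall s k b, (Wmat t w Om p (n s) ^+ k) b b = \sum_a q b a * lam (s := s) a ^+ k.

(** Zero when [i] is not a node, so that it can be summed over the full grid as a Riemann sum. *)
Definition local_defect (s : nat) (i : Idx (n s)) : R :=
  \sum_(b : 'I_#|nodes Om (n s)| | enum_val b == i)
   (\sum_a q b a * F (lam a) -
    theta_avg s.+1 (fun th => F (p (gridpt R i) * symbol t w th))).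

Lemma local_defect_bound s (i : Idx (n s)) : `|local_defect i| <= C + C.
Proof.
have C0 : 0 <= C by apply: le_trans (FC 0).
have [iN|iN] := boolP (i \in nodes Om (n s)); last first.
  rewrite /local_defect big_pred0 ?normr0 ?addr_ge0// => b; apply/negbTE.
  by apply: contra iN => /eqP <-; exact: enum_valP.
rewrite -(node_sum (C + C) iN) /local_defect (le_trans (ler_norm_sum _ _ _))//.
apply: ler_sum => b _; rewrite (le_trans (ler_normB _ _))// lerD//; last exact: theta_avg_norm.
rewrite (le_trans (ler_norm_sum _ _ _))// -[leRHS]mul1r -(q1 b) mulr_suml ler_sum// => a _.
by rewrite normrM ger0_norm// ler_wpM2l.
Qed.

Variables (j : forall s, Idx (n s)) (y : 'I_d -> R).
Hypothesis sn : forall s r, (s < n s r)%N.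
Hypothesis jy : forall r, (fun s => gridpt R (j s) r) @ \oo --> y r.
Hypothesis y01 : forall r, 0 < y r < 1.
Hypothesis yOm : exists2 del : R, 0 < del & forall z, (forall r, `|z r - y r| < del) -> Om z.
Hypothesis py : forall e : R, 0 < e -> exists2 del : R, 0 < del &
  forall z, Om z -> (forall r, `|z r - y r| < del) -> `|p z - p y| < e.

(** Once [s >= k * T] the average of the k-th power of the symbol equals [convpow] exactly, and only
    the factor in [p] still moves. *)
Lemma cvg_theta_moment k :
  (fun s => theta_avg s.+1 (fun th => (p (gridpt R (j s)) * symbol t w th) ^+ k)) @ \oo -->
  p y ^+ k * convpow t w k 0.
Proof.
pose T := (\sum_(k < m) \sum_(r < d) t k r)%N.
have tT k' r : (t k' r <= T)%N.
  by rewrite /T (bigD1 k')//= (bigD1 r)//= -addnA leq_addr.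
have E : \forall s \near \oo, p (gridpt R (j s)) ^+ k * convpow t w k 0 =
    theta_avg s.+1 (fun th => (p (gridpt R (j s)) * symbol t w th) ^+ k).
  exists (k * T)%N => // s /= ks.
  rewrite -(@avg_symbol_pow _ _ _ t w t_pos t_incr T tT s.+1 k 0)//; last first.
    by move=> r; rewrite ffunE absz0 add0n ltnS.
  rewrite /theta_avg mulrCA; congr (_ * _); rewrite mulr_sumr; apply: eq_bigr => l _.
  rewrite exprMn /dotZ big1 ?cos0 ?mulr1// => r _.
  by rewrite ffunE mul0r.
apply: cvg_trans (near_eq_cvg E) _; apply: cvgMr_tmp.
elim: k {E} => [|k IH]; first exact: cvg_cst.
under eq_fun do rewrite exprS.
by rewrite exprS; apply: cvgM => //; exact: (cvg_weight yOm py).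
Qed.

Lemma cvg_local_defect : (fun s => local_defect (j s)) @ \oo --> (0 : R).
Proof.
apply/cvgr0Pnorm_le => e e0.
have [S S0 hS] := symbol_bound.
have py1 : 1 <= `|p y| + 1 by rewrite lerDr.
(* Eventually [p] at the node is at most [|p y| + 1] in absolute value, and [S] bounds the symbol;
   the added 1 secures [1 <= B]. *)
pose B := 1 + (`|p y| + 1) * S.
have B1 : 1 <= B by rewrite lerDl mulr_ge0 ?addr_ge0 ?(ltW S0).
have [K [eta eta0 hK]] := moment_comparison cF FC B1 e0.
(* Only the moments up to [K] are needed, so finitely many limits hold simultaneously from some [s]
   on. *)
have h1 : \forall s \near \oo, forall k : 'I_K.+1,
   `|node_entry t w Om p k (j s) 0 -
     theta_avg s.+1 (fun th => (p (gridpt R (j s)) * symbol t w th) ^+ k)| < eta.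
  apply: filter_forall => k /=.
  have h : (fun s => node_entry t w Om p k (j s) 0 -
     theta_avg s.+1 (fun th => (p (gridpt R (j s)) * symbol t w th) ^+ k)) @ \oo --> (0 : R).
    rewrite -(subrr (p y ^+ k * convpow t w k 0)); apply: cvgB; last exact: cvg_theta_moment.
    exact: cvg_node_entry.
  exact: ((cvgr0Pnorm_lt _).1 h eta eta0).
have h2 : \forall s \near \oo, `|p (gridpt R (j s)) - p y| < 1.
  have := cvg_weight yOm py jy.
  by move=> /cvgrPdist_lt /(_ 1 ltr01); apply: filterS => s; rewrite distrC.
have h3 := near_node jy yOm.
near=> s.
have jN : j s \in nodes Om (n s) by near: s.
have hk : forall k : 'I_K.+1, `|node_entry t w Om p k (j s) 0 -
     theta_avg s.+1 (fun th => (p (gridpt R (j s)) * symbol t w th) ^+ k)| < eta by near: s.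
have hp : `|p (gridpt R (j s)) - p y| < 1 by near: s.
pose b := enum_rank_in jN (j s).
have bE : enum_val b = j s by rewrite enum_rankK_in.
have bP (b' : 'I_#|nodes Om (n s)|) : (enum_val b' == j s) = (b' == b).
  by rewrite -bE (inj_eq enum_val_inj).
rewrite /local_defect (big_pred1 b)//.
have entE k : node_entry t w Om p k (j s) 0 = \sum_a q b a * lam a ^+ k.
  rewrite /node_entry (big_pred1 b)// /shifted_entry (big_pred1 b) -?qlam// => c.
  apply/eqP/eqP => [|->]; last by apply/ffunP => r; rewrite !ffunE subrr.
  move=> h; apply/enum_val_inj; apply: (@idx_diff_inj _ _ (enum_val b)); rewrite h.
  by apply/ffunP => r; rewrite !ffunE subrr.
have MR : (s.+1%:R : R) ^+ d != 0 by rewrite expf_neq0.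
rewrite /theta_avg mulr_sumr; apply: hK => //.
- by rewrite sumr_const card_ffun !card_ord -(mulr_natl _ (_ ^ _)%N) natrX divff.
- move=> l; rewrite normrM /B ler_wpDl//; apply: ler_pM => //.
  rewrite -[p _](subrK (p y)) addrC (le_trans (ler_normD _ _))//; lra.
- move=> k kK; have := hk (Ordinal (kK : (k < K.+1)%N)).
  by rewrite /= entE /theta_avg mulr_sumr => /ltW.
Unshelve. all: by end_near. Qed.

End local_spectral.

(** * Averages over the grid *)

Section product_grid.
Variables (R : realType) (d : nat).

Definition join_coord (T : Type) (x y : 'I_d -> T) (r : 'I_(d + d)) : T :=
  match fintype.split r with inl i => x i | inr i => y i end.

Lemma join_coordl T (x y : 'I_d -> T) i : join_coord x y (lshift d i) = x i.
Proof. by rewrite /join_coord (unsplitK (inl i)). Qed.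

Lemma join_coordr T (x y : 'I_d -> T) i : join_coord x y (rshift d i) = y i.
Proof. by rewrite /join_coord (unsplitK (inr i)). Qed.

(** [U] reads indices as natural numbers, which lets the two dependent index types be compared. *)
Lemma sum_join_Idx (n : 'I_d -> nat) (M : nat) (U : ('I_(d + d) -> nat) -> R) :
  \sum_(J : Idx (join_coord n (fun _ => M))) U (fun r => J r) =
  \sum_(i : Idx n) \sum_(l : {ffun 'I_d -> 'I_M}) U (join_coord (fun r => i r : nat) (fun r => l r : nat)).
Proof.
set nn := join_coord _ _.
have lt_join (i : Idx n) (l : {ffun 'I_d -> 'I_M}) r :
    (join_coord (fun r => i r : nat) (fun r => l r : nat) r < nn r)%N.
  by rewrite /nn /join_coord; case: fintype.split => q; exact: ltn_ord.
pose h (il : Idx n * {ffun 'I_d -> 'I_M}) : Idx nn :=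
  [ffun r => Ordinal (lt_join il.1 il.2 r)].
pose g (J : Idx nn) : Idx n * {ffun 'I_d -> 'I_M} :=
  ([ffun q => cast_ord (join_coordl n (fun _ => M) q) (J (lshift d q))],
   [ffun q => cast_ord (join_coordr n (fun _ => M) q) (J (rshift d q))]).
have hK : cancel h g.
  move=> [i l]; congr (_, _); apply/ffunP => q; apply/val_inj; rewrite !ffunE /= ?ffunE /=.
    exact: join_coordl.
  exact: join_coordr.
have gK : cancel g h.
  move=> J; apply/ffunP => r; apply/val_inj; rewrite ffunE /= /g /join_coord /=.
  by case: split_ordP => q ->; rewrite ffunE.
rewrite pair_big /= (reindex h); last by exists g => x _; [exact: hK|exact: gK].
apply: eq_bigr => -[i l] _ /=; congr U; apply/funext => r.
by rewrite /h ffunE.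
Qed.

End product_grid.

Section cell_limits.
Variables (R : realType) (k : nat) (a L y : 'I_k -> R) (n N : nat -> 'I_k -> nat).
Hypothesis L0 : forall r, 0 < L r.
Hypothesis sn : forall s r, (s < n s r)%N.
Hypothesis nN : forall s r, (n s r <= N s r <= (n s r).+1)%N.

(** The upper corner of the cell exceeds [y] by at most the step, itself at most L/(s+1). *)
Lemma cell_cvg (j : forall s, Idx (n s)) r :
  (\forall s \near \oo, cell a (fun r => L r / (N s r)%:R) (fun r => j s r) y) ->
  (fun s => a r + (j s r).+1%:R * (L r / (N s r)%:R)) @ \oo --> y r.
Proof.
move=> jy.
have Lh : (fun s => y r + L r * @harmonic R s) @ \oo --> y r.
  rewrite -[X in _ --> X]addr0; apply: cvgD; first exact: cvg_cst.
  by rewrite -(mulr0 (L r)); apply: cvgMl_tmp; exact: cvg_harmonic.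
apply: (squeeze_cvgr _ (cvg_cst (y r)) Lh); apply: filterS jy => s /(_ r) /andP[y1 y2].
rewrite y2 /= -[(j s r).+1%:R]natr1 mulrDl mul1r addrA lerD ?(ltW y1)// ler_wpM2l ?(ltW (L0 r))//.
have /andP[nN1 _] := nN s r.
have sN : (s < N s r)%N := leq_trans (sn s r) nN1.
by rewrite /harmonic lef_pV2 ?posrE ?ltr0n// ?ler_nat// (leq_trans _ sN).
Qed.

End cell_limits.

Lemma caratheodory_null_measurable (R : realType) (T : pointedType)
    (mu : {outer_measure set T -> \bar R}) (A : set T) :
  mu A = 0%E -> measurable (A : set (caratheodory_type mu)).
Proof.
move=> A0; apply: le_caratheodory_measurable => X.
suff -> : mu (X `&` A) = 0%E by rewrite add0e le_outer_measure //; apply: subIset; left.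
by apply/eqP; rewrite eq_le outer_measure_ge0 andbT -A0 le_outer_measure//; apply: subIset; right.
Qed.

Section boundary.
Variables (R : realType) (d : nat) (Om : set ('I_d -> R)).

Lemma not_boundary x : ~ boundary Om x ->
  (exists2 del : R, 0 < del & forall z, (forall r, `|z r - x r| < del) -> Om z) \/
  (exists2 del : R, 0 < del & forall z, (forall r, `|z r - x r| < del) -> ~ Om z).
Proof.
move=> /existsNP[del /not_implyP[del0 /not_andP[h|h]]].
  by right; exists del => // z zx Oz; apply: h; exists z.
by left; exists del => // z zx; apply: contrapT => Oz; apply: h; exists z.
Qed.

Lemma boundary_negligible : lebV (boundary Om) = 0%E -> leb_negligible (boundary Om).
Proof.
move=> b0; exists (@vec_of R d @^-1` boundary Om); split => //.
exact/caratheodory_null_measurable.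
Qed.
End boundary.

(** Measurability of [D] is read off its indicator, for which [riemann_sum_cvg] supplies the
    hypotheses. *)
Lemma indicator_leb_integral (R : realType) (k : nat) (D : set ('I_k -> R)) :
  measurable_fun setT (cst (1 : R) \_ D \o @vec_of R k) ->
  (@lebd R k).-integrable setT (EFin \o (cst (1 : R) \_ D \o @vec_of R k)) ->
  (lebV D < +oo)%E /\ leb_integral D (cst 1) = fine (lebV D).
Proof.
move=> mf fi.
have mD : measurable (@vec_of R k @^-1` D : set (Rpt R k)).
  have -> : @vec_of R k @^-1` D = setT `&` (cst (1 : R) \_ D \o @vec_of R k) @^-1` [set 1].
    rewrite setTI; apply/seteqP; split=> y /=; rewrite patchE.
      by move=> Dy; rewrite mem_set.
    by case: ifPn => [|_ /esym/eqP]; rewrite ?oner_eq0// inE.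
  exact: mf.
have muD : (\int[@lebd R k]_y ((cst (1 : R) \_ D) (vec_of y))%:E)%E = lebV D.
  rewrite -[RHS]mul1e -(integral_cst (@lebd R k) mD 1%E) [RHS]integral_mkcond.
  apply: eq_integral => y _; rewrite !patchE.
  have [Dy|Dy] := pselect (D (vec_of y)); first by rewrite !mem_set.
  by rewrite !memNset.
split.
  rewrite -muD; have := integrable_fin_num measurableT fi.
  by rewrite ge0_fin_numE// integral_ge0// => y _; rewrite /= lee_fin patchE; case: ifP.
rewrite /leb_integral /Rintegral; congr fine.
by rewrite (integral_cst (@lebd R k) mD 1%E) mul1e.
Qed.

Section sampling.
Variables (R : realType) (d : nat) (Om : set ('I_d -> R)) (p : ('I_d -> R) -> R).
Hypothesis hreg : regular_domain Om.
Hypothesis hae : ae_continuous_on Om p.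
Variable n : nat -> 'I_d -> nat.
Hypothesis sn : forall s r, (s < n s r)%N.

Definition cell_vol (n : 'I_d -> nat) : R := \prod_(r < d) (n r).+1%:R^-1.

Definition discontinuities : set ('I_d -> R) :=
  [set x | Om x /\ ~ (forall e : R, 0 < e -> exists2 del : R, 0 < del &
     forall y, Om y -> (forall r, `|y r - x r| < del) -> `|p y - p x| < e)].

Lemma cell_gridpt_cvg (y : 'I_d -> R) (j : forall s, Idx (n s)) :
  (\forall s \near \oo, cell (fun _ => 0) (fun r => 1 / (n s r).+1%:R) (fun r => j s r) y) ->
  forall r, (fun s => gridpt R (j s) r) @ \oo --> y r.
Proof.
move=> jy r; have nN s r' : (n s r' <= (n s r').+1 <= (n s r').+1)%N by rewrite leqnSn /=.
have := @cell_cvg R d (fun _ => 0) (fun _ => 1) y n (fun s r => (n s r).+1)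
  (fun _ => ltr01) sn nN j r jy.
rewrite (_ : (fun s => 0 + _) = (fun s => gridpt R (j s) r))//.
by apply/funext => s; rewrite /gridpt add0r div1r.
Qed.

Lemma sample_cvg (u : forall s, Idx (n s) -> R) (C : R) (f : ('I_d -> R) -> R) :
  (forall s j, `|u s j| <= C) ->
  (forall (y : 'I_d -> R) (j : forall s, Idx (n s)),
     ~ boundary Om y -> ~ discontinuities y -> (forall r, 0 < y r < 1) ->
     (forall r, (fun s => gridpt R (j s) r) @ \oo --> y r) ->
     (fun s => u s (j s)) @ \oo --> (f \_ Om) y) ->
  [/\ measurable_fun setT (f \_ Om \o @vec_of R d),
     (@lebd R d).-integrable setT (EFin \o (f \_ Om \o @vec_of R d)) &
  (fun s => cell_vol (n s) * \sum_j u s j) @ \oo --> leb_integral Om f].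
Proof.
move=> uC uf; have [Omc mOm bOm] := hreg.
have nN s r' : (n s r' <= (n s r').+1 <= (n s r').+1)%N by rewrite leqnSn /=.
have [|||m1 m2 m3] := @riemann_sum_cvg R d (fun _ => 0) (fun _ => 1) n
  (fun s r => (n s r).+1) (fun _ => ltr01) sn nN u C Om f
  (@vec_of R d @^-1` boundary Om `|` @vec_of R d @^-1` discontinuities) uC.
- by move=> y Oy r; rewrite add0r; exact: Omc.
- by apply: negligibleU; [exact: boundary_negligible|exact: hae].
- move=> y yZ y01 j jy; apply: uf.
  + by move=> h; apply: yZ; left.
  + by move=> h; apply: yZ; right.
  + by move=> r; have := y01 r; rewrite add0r.
  + exact: cell_gridpt_cvg.
split => //; apply: cvg_trans m3; apply: near_eq_cvg; apply: nearW => s.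
by congr (_ * _); apply: eq_bigr => r _; rewrite div1r.
Qed.

Lemma node_indicator_cvg (y : 'I_d -> R) (j : forall s, Idx (n s)) : ~ boundary Om y ->
  (forall r, (fun s => gridpt R (j s) r) @ \oo --> y r) ->
  \forall s \near \oo, (j s \in nodes Om (n s)) = `[< Om y >].
Proof.
move=> by0 jy; have [[del del0 h]|[del del0 h]] := not_boundary by0.
  have -> : `[< Om y >] by apply/asboolP; apply: h => r; rewrite subrr normr0.
  by apply: filterS (near_coord jy del0) => s /h Os; rewrite inE; apply/asboolP.
have -> : `[< Om y >] = false by apply/asboolPn; apply: h => r; rewrite subrr normr0.
by apply: filterS (near_coord jy del0) => s /h Os; rewrite inE; apply/asboolPn.
Qed.

Lemma count_cvg : (lebV Om < +oo)%E /\
  (fun s => cell_vol (n s) * #|nodes Om (n s)|%:R) @ \oo --> fine (lebV Om).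
Proof.
have [||m1 m2 m3] := @sample_cvg (fun s j => (j \in nodes Om (n s))%:R) 1 (cst 1).
- by move=> s j; case: (_ \in _); rewrite ?normr1 ?normr0.
- move=> y j y1 _ _ jy; apply: cvg_near_cst.
  apply: filterS (node_indicator_cvg y1 jy) => s ->; rewrite patchE.
  by have [Oy|Oy] := pselect (Om y); [rewrite mem_set// asboolT|rewrite memNset// asboolF].
have [h1 h2] := indicator_leb_integral m1 m2; split => //.
rewrite -h2; apply: cvg_trans m3; apply: near_eq_cvg; apply: nearW => s.
congr (_ * _); rewrite -sum1_card natr_sum [RHS]big_mkcond /=.
by apply: eq_bigr => i _; case: ifP.
Qed.

Variables (m : nat) (t : 'I_m -> 'I_d -> nat) (w : {ffun 'I_d -> int} -> R).
Hypothesis t_pos : forall k : 'I_m, lexlt (fun _ => 0%N) (t k).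
Hypothesis t_incr : forall k1 k2 : 'I_m, (k1 < k2)%N -> lexlt (t k1) (t k2).
Variables (F : R -> R) (C : R).
Hypothesis cF : continuous F.
Hypothesis FC : forall x, `|F x| <= C.

Lemma symbol_continuous (z : nat -> 'I_d -> R) (th : 'I_d -> R) :
  (forall r, z ^~ r @ \oo --> th r) ->
  (fun s => symbol t w (z s)) @ \oo --> symbol t w th.
Proof.
move=> zth; under eq_fun do rewrite symbolE//; rewrite symbolE//.
apply: cvg_sum_seq => u; apply: cvgMl_tmp.
apply: (@cvg_comp _ _ _ (fun s => dotZ u (z s)) cos _ (nbhs (dotZ u th)));
  last exact: continuous_cos.
by apply: cvg_sum_seq => r; apply: cvgMl_tmp; exact: zth.
Qed.

Definition sample_symbol (z : 'I_(d + d) -> R) : R := p (xpart z) * symbol t w (thpart z).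

Lemma symbol_sample_cvg :
  [/\ measurable_fun setT ((F \o sample_symbol) \_ (OmXcube Om) \o @vec_of R (d + d)),
     (@lebd R (d + d)).-integrable setT
       (EFin \o ((F \o sample_symbol) \_ (OmXcube Om) \o @vec_of R (d + d))) &
  (fun s => cell_vol (n s) * (2 * pi) ^+ d * \sum_(i in nodes Om (n s))
     theta_avg s.+1 (fun th => F (p (gridpt R i) * symbol t w th))) @ \oo -->
     leb_integral (OmXcube Om) (F \o sample_symbol)].
Proof.
have [Omc mOm bOm] := hreg; have pi0 := pi_gt0 R.
(* The box [0,1]^d times [-pi, pi]^d, with cells of step 1/(n+1) in x and 2 pi/(s+1) in theta; their
   upper corners are the pairs of a [gridpt] and a [theta]. *)
pose a : 'I_(d + d) -> R := join_coord (fun _ => 0) (fun _ => - pi).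
pose L : 'I_(d + d) -> R := join_coord (fun _ => 1) (fun _ => 2 * pi).
pose nn s : 'I_(d + d) -> nat := join_coord (n s) (fun _ => s.+1).
pose N s : 'I_(d + d) -> nat := join_coord (fun r => (n s r).+1) (fun _ => s.+1).
have L0 r : 0 < L r by rewrite /L /join_coord; case: fintype.split => _ //; lra.
have snn s r : (s < nn s r)%N by rewrite /nn /join_coord; case: fintype.split.
have nN s r : (nn s r <= N s r <= (nn s r).+1)%N.
  by rewrite /nn /N /join_coord; case: fintype.split => q; rewrite leqnSn leqnn.
pose pt s (J : 'I_(d + d) -> nat) r := a r + (J r).+1%:R * (L r / (N s r)%:R).
pose H := (F \o sample_symbol) \_ (OmXcube Om).
pose Z : set (Rpt R (d + d)) :=
  [set y | boundary Om (fun r => vec_of y (lshift d r))] `|`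
  [set y | discontinuities (fun r => vec_of y (lshift d r))].
have C0 : 0 <= C by apply: le_trans (FC 0).
have [||||m1 m2 m3] := @riemann_sum_cvg R (d + d) a L nn N L0 snn nN
  (fun s J => H (pt s (fun r => J r))) C (OmXcube Om) (F \o sample_symbol) Z.
- move=> s J; rewrite /H patchE; case: ifP => _; first exact: FC.
  by rewrite [point]/(0 : R) normr0.
- move=> y [Oy thy] r; rewrite /a /L /join_coord; case: split_ordP => q ->.
    by rewrite add0r; exact: Omc Oy q.
  by have := thy q; rewrite /thpart; lra.
- apply: negligibleU; first exact/negligible_xpart/boundary_negligible.
  exact: (@negligible_xpart R d d discontinuities hae).
- move=> y yZ yL j jy; set z := vec_of y in yL jy *.
  have zb : ~ boundary Om (xpart z) by move=> h; apply: yZ; left.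
  have zd : ~ discontinuities (xpart z) by move=> h; apply: yZ; right.
  have ptz r : (fun s => pt s (fun r => j s r) r) @ \oo --> z r.
    exact: cell_cvg jy.
  have thz r : - pi < thpart z r < pi.
    by have := yL (rshift d r); rewrite /a /L !join_coordr /thpart; lra.
  have thcube : \forall s \near \oo, forall r, - pi <= thpart (pt s (fun r => j s r)) r <= pi.
    apply: filter_forall => r; have /andP[th1 th2] := thz r.
    have e0 : 0 < Num.min (thpart z r + pi) (pi - thpart z r).
      by rewrite lt_min; apply/andP; split; lra.
    have /cvgrPdist_lt /(_ _ e0) := ptz (rshift d r).
    apply: filterS => s; rewrite lt_min !ltr_norml /thpart => /andP[/andP[? ?] /andP[? ?]].
    by apply/andP; split; lra.
  have xz r : (fun s => xpart (pt s (fun r => j s r)) r) @ \oo --> xpart z r by exact: ptz.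
  (* At an interior point of [Om] the samples converge by continuity; at an exterior point they
     eventually vanish, as does the restricted limit. *)
  have [[del del0 h]|[del del0 h]] := not_boundary zb; last first.
    apply: cvg_near_cst; have := near_coord xz del0; apply: filterS => s /h hs.
    rewrite /H !patchE memNset; last by case=> /hs.
    rewrite memNset// => -[Oz _].
    by apply: (h (xpart z)) Oz => r; rewrite subrr normr0.
  have Oz : Om (xpart z) by apply: h => r; rewrite subrr normr0.
  rewrite patchE mem_set; last first.
    by split => // r; have /andP[? ?] := thz r; rewrite !ltW.
  have E : \forall s \near \oo, F (sample_symbol (pt s (fun r => j s r))) =
      H (pt s (fun r => j s r)).
    apply: filterS2 thcube (near_coord xz del0) => s h1 /h h2.
    by rewrite /H patchE mem_set.
  apply: cvg_trans (near_eq_cvg E) _.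
  apply: (@cvg_comp _ _ _ (fun s => sample_symbol (pt s (fun r => j s r))) F _
    (nbhs (sample_symbol z))); last exact: cF.
  apply: cvgM; last by apply: symbol_continuous => r; exact: ptz.
  apply: (@cvg_weight R d Om p (xpart z) _ _ _ xz); first by exists del.
  move=> e e0; apply: contrapT => he; apply: zd; split=> // h1.
  exact: he (h1 e e0).
split => //; apply: cvg_trans m3; apply: near_eq_cvg; apply: nearW => s.
rewrite (sum_join_Idx (n s) s.+1 (fun J => H (pt s J))) big_split_ord /=.
have -> : \prod_(i < d) (L (lshift d i) / (N s (lshift d i))%:R) = cell_vol (n s).
  by apply: eq_bigr => r _; rewrite /L /N !join_coordl div1r.
have -> : \prod_(i < d) (L (rshift d i) / (N s (rshift d i))%:R) =
    (2 * pi) ^+ d * (s.+1%:R ^+ d)^-1.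
  rewrite (eq_bigr (fun _ => 2 * pi / s.+1%:R)).
    by rewrite prodr_const card_ord exprMn exprVn.
  by move=> r _; rewrite /L /N !join_coordr.
rewrite -!mulrA; congr (_ * (_ * _)); rewrite mulr_sumr [RHS]big_mkcond /=.
apply: eq_bigr => i _.
have xpt (l : {ffun 'I_d -> 'I_s.+1}) :
    xpart (pt s (join_coord (fun r => i r : nat) (fun r => l r : nat))) = gridpt R i.
  by apply/funext => r; rewrite /xpart /pt /a /L /N !join_coordl add0r /gridpt div1r.
have thpt (l : {ffun 'I_d -> 'I_s.+1}) :
    thpart (pt s (join_coord (fun r => i r : nat) (fun r => l r : nat))) = theta R l.
  apply/funext => r; rewrite /thpart /pt /a /L /N !join_coordr /theta; congr (_ + _); ring.
case: ifPn => iN; last first.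
  rewrite big1 ?mulr0// => l _; rewrite /H patchE memNset// => -[].
  by rewrite xpt => Oi; case/negP: iN; rewrite inE; apply/asboolP.
rewrite /theta_avg; congr (_ * _); apply: eq_bigr => l _.
rewrite /H patchE mem_set; first by rewrite /= /sample_symbol xpt thpt.
split; first by rewrite xpt; move: iN; rewrite inE => /asboolP.
move=> r; rewrite thpt /theta.
have h1 : 0 <= 2 * pi * (l r).+1%:R / s.+1%:R :> R by rewrite divr_ge0 ?mulr_ge0// ltW.
have h2 : 2 * pi * (l r).+1%:R / s.+1%:R <= 2 * pi :> R.
  by rewrite ler_pdivrMr ?ltr0n// ler_wpM2l ?mulr_ge0 ?(ltW pi0)// ler_nat ltn_ord.
move: (2 * pi * _ / _) h1 h2 => x h1 h2.
by apply/andP; split; lra.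
Qed.

End sampling.

(** * Averages of the spectral measures *)

Section spectral_average.
Variables (R : realType) (d : nat) (Om : set ('I_d -> R)) (p : ('I_d -> R) -> R).
Hypothesis hreg : regular_domain Om.
Hypothesis hpos : (0 < lebV Om)%E.
Hypothesis hae : ae_continuous_on Om p.
Variable n : nat -> 'I_d -> nat.
Hypothesis sn : forall s r, (s < n s r)%N.
Variables (m : nat) (t : 'I_m -> 'I_d -> nat) (w : {ffun 'I_d -> int} -> R).
Hypothesis t_pos : forall k : 'I_m, lexlt (fun _ => 0%N) (t k).
Hypothesis t_incr : forall k1 k2 : 'I_m, (k1 < k2)%N -> lexlt (t k1) (t k2).
Variables (F : R -> R) (C : R).
Hypothesis cF : continuous F.
Hypothesis FC : forall x, `|F x| <= C.
Variables (lam : forall s, 'I_#|nodes Om (n s)| -> R)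
  (q : forall s, 'I_#|nodes Om (n s)| -> 'I_#|nodes Om (n s)| -> R).
Hypothesis q0 : forall s b a, 0 <= q (s := s) b a.
Hypothesis q1 : forall s b, \sum_a q (s := s) b a = 1.
Hypothesis q1' : forall s a, \sum_b q (s := s) b a = 1.
Hypothesis qlam : forall s k b, (Wmat t w Om p (n s) ^+ k) b b = \sum_a q b a * lam (s := s) a ^+ k.

(** Summing the spectral measures over all nodes gives each eigenvalue total weight 1, by [q1']. *)
Lemma sum_local_defect s : \sum_i local_defect t w p F lam q (s := s) i =
  \sum_a F (lam (s := s) a) - \sum_(i in nodes Om (n s))
     theta_avg s.+1 (fun th => F (p (gridpt R i) * symbol t w th)).
Proof.
pose G (b : 'I_#|nodes Om (n s)|) := \sum_a q b a * F (lam a) -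
  theta_avg s.+1 (fun th => F (p (gridpt R (enum_val b)) * symbol t w th)).
transitivity (\sum_b G b).
  rewrite (partition_big (@enum_val _ _ : 'I_#|nodes Om (n s)| -> Idx (n s)) predT)//=.
  by apply: eq_bigr => i _; apply: eq_bigr => b /eqP bi; rewrite /G bi.
rewrite /G sumrB; congr (_ - _); last by rewrite [RHS]big_enum_val.
rewrite exchange_big /=; apply: eq_bigr => a _.
by rewrite -mulr_suml q1' mul1r.
Qed.

Lemma cvg_sum_local_defect :
  (fun s => cell_vol R (n s) * \sum_i local_defect t w p F lam q (s := s) i) @ \oo --> (0 : R).
Proof.
have [||_ _ h] := @sample_cvg R d Om p hreg hae n sn
  (fun s i => local_defect t w p F lam q (s := s) i) (C + C) (cst 0).
- by move=> s j; exact: local_defect_bound.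
- move=> y j yb yd y01 jy.
  have -> : (cst 0 \_ Om) y = 0 :> R by rewrite patchE; case: ifP.
  have [yO|yO] := not_boundary yb; last first.
    have nOy : ~ Om y by have [del del0 hO] := yO; apply: hO => r; rewrite subrr normr0.
    apply: cvg_near_cst; have := node_indicator_cvg yb jy.
    rewrite asboolF//; apply: filterS => s js; rewrite /local_defect big_pred0// => b.
    by apply: contraFF js => /eqP <-; exact: enum_valP.
  apply: (cvg_local_defect (C := C) t_pos t_incr cF FC q0 q1 qlam sn jy y01 yO).
  have Oy : Om y by have [del del0 hO] := yO; apply: hO => r; rewrite subrr normr0.
  move=> e e0; apply: contrapT => he; apply: yd; split=> // h1.
  exact: he (h1 e e0).
have e0 : leb_integral Om (cst 0) = 0 :> R by rewrite /leb_integral /Rintegral integral0_eq.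
by rewrite e0 in h.
Qed.

(** The same Riemann sum is evaluated twice: with [F = 1] on the product domain, and as (2 pi)^d
    times the node count in [Om]. Uniqueness of limits then gives the measure of the product domain,
    hence its positivity, without Fubini for the completed measures. *)
Lemma node_count_cvg : 0 < fine (lebV (OmXcube Om)) /\
  (fun s => cell_vol R (n s) * (2 * pi) ^+ d * #|nodes Om (n s)|%:R) @ \oo -->
    fine (lebV (OmXcube Om)).
Proof.
have c0 : 0 < (2 * pi) ^+ d :> R by rewrite exprn_gt0// mulr_gt0// pi_gt0.
have c1 : continuous (cst 1 : R -> R) by move=> x; exact: cvg_cst.
have n1 (x : R) : `|(cst 1 : R -> R) x| <= 1 by rewrite /= normr1.
have [m1 m2 m3] := @symbol_sample_cvg R d Om p hreg hae n sn m t w t_pos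
  (cst 1) 1 c1 n1.
have [_ e] := indicator_leb_integral m1 m2.
have h1 : (fun s => cell_vol R (n s) * (2 * pi) ^+ d * #|nodes Om (n s)|%:R) @ \oo -->
    fine (lebV (OmXcube Om)).
  rewrite -e; apply: cvg_trans m3; apply: near_eq_cvg; apply: nearW => s.
  congr (_ * _); rewrite -sum1_card natr_sum; apply: eq_bigr => i _.
  rewrite /theta_avg sumr_const card_ffun !card_ord -(mulr_natl _ (_ ^ _)%N) natrX mulr1.
  by rewrite mulVf// expf_neq0.
split => //; have [Ofin h2] := count_cvg hreg hae sn.
have L0 : 0 < fine (lebV Om) by rewrite fine_gt0// hpos Ofin.
have h3 : (fun s => cell_vol R (n s) * (2 * pi) ^+ d * #|nodes Om (n s)|%:R) @ \oo -->
    (2 * pi) ^+ d * fine (lebV Om).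
  by under eq_fun do rewrite [_ * (2 * pi) ^+ d]mulrC -mulrA; apply: cvgMl_tmp.
by rewrite (cvg_unique _ h1 h3)// mulr_gt0.
Qed.

Lemma cvg_spectral_average :
  (fun s => #|nodes Om (n s)|%:R^-1 * \sum_a F (lam (s := s) a)) @ \oo -->
  (fine (lebV (OmXcube Om)))^-1 * leb_integral (OmXcube Om) (F \o sample_symbol p t w).
Proof.
have [L0 h1] := node_count_cvg.
have [_ _ h2] := symbol_sample_cvg hreg hae sn w t_pos cF FC.
have c0 : 0 < (2 * pi) ^+ d :> R by rewrite exprn_gt0// mulr_gt0// pi_gt0.
have V0 s : cell_vol R (n s) * (2 * pi) ^+ d != 0.
  by rewrite mulf_neq0 ?(gt_eqF c0)//; apply/prodf_neq0 => r _; rewrite invr_eq0.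
have -> : (fun s => #|nodes Om (n s)|%:R^-1 * \sum_a F (lam (s := s) a)) =
  (fun s => (cell_vol R (n s) * (2 * pi) ^+ d * #|nodes Om (n s)|%:R)^-1 *
    ((2 * pi) ^+ d * (cell_vol R (n s) * \sum_i local_defect t w p F lam q (s := s) i) +
     cell_vol R (n s) * (2 * pi) ^+ d * \sum_(i in nodes Om (n s))
     theta_avg s.+1 (fun th => F (p (gridpt R i) * symbol t w th)))).
  apply/funext => s; rewrite sum_local_defect mulrA [(2 * pi) ^+ d * _]mulrC -mulrDr subrK.
  by rewrite invfM mulrACA [X in _ = X * _]mulVf// mul1r.
apply: cvgM; first by apply: cvgV => //; rewrite gt_eqF.
rewrite -[leb_integral _ _]add0r; apply: cvgD; last exact: h2.
rewrite -[X in _ --> X](mulr0 ((2 * pi) ^+ d)); apply: cvgMl_tmp.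
exact: cvg_sum_local_defect.
Qed.

End spectral_average.

(** * Real and imaginary parts of the test function *)

Section test_functions.
Local Open Scope complex_scope.
Local Open Scope ring_scope.
Variable R : realType.

Lemma normcC (x : R) : `|x%:C| = `|x|%:C.
Proof. by rewrite normc_def /= expr0n addr0 sqrtr_sqr. Qed.

Lemma normc_lt (a b e : R) : `|a| < e / 2 -> `|b| < e / 2 -> `|a +i* b| < e%:C.
Proof.
move=> ha hb; have e0 : 0 < e by have := normr_ge0 a; lra.
rewrite normc_def /= ltcR -[ltRHS](gtr0_norm e0) -sqrtr_sqr ltr_sqrt ?exprn_gt0//.
rewrite -(real_normK (num_real a)) -(real_normK (num_real b)).
by have := normr_ge0 a; have := normr_ge0 b; nra.
Qed.

Lemma Re_norm (z : R[i]) (e : R) : `|z| < e%:C -> `|complex.Re z| < e.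
Proof. by move=> h; rewrite -ltcR -normcC (le_lt_trans _ h)// normcC normc_ge_Re. Qed.

Lemma Im_norm (z : R[i]) (e : R) : `|z| < e%:C -> `|complex.Im z| < e.
Proof.
move=> h; rewrite -ltcR (le_lt_trans _ h)// normc_def lecR -sqrtr_sqr ler_sqrt.
  by rewrite lerDr sqr_ge0.
by rewrite addr_ge0 ?sqr_ge0.
Qed.

Lemma supported_bounded (f : R -> R) (M : R) : continuous f ->
  (forall x, M < `|x| -> f x = 0) -> exists C, forall x, `|f x| <= C.
Proof.
(* [M] may be negative; its absolute value gives a nonempty interval on which to take a maximum. *)
move=> cf f0; pose N := `|M|.
have NN : - N <= N by have := normr_ge0 M; rewrite -/N; lra.
have [|c _ hc] := @EVT_max R (fun x => `|f x|) (- N) N NN.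
  apply: continuous_subspaceT => x.
  by apply: (@continuous_comp _ _ _ f (fun y => `|y|)); [exact: cf|exact: norm_continuous].
exists `|f c| => x; have [xN|xN] := leP `|x| N.
  by apply: hc; rewrite in_itv /= -ler_norml.
by rewrite f0 ?normr0// (le_lt_trans (ler_norm M)).
Qed.

Lemma ccontinuous_part (h : R[i] -> R) (F : R[i] -> R[i]) : ccontinuous F ->
  (forall z z', h z - h z' = h (z - z')) ->
  (forall z e, `|z| < e%:C -> `|h z| < e) ->
  continuous (fun x : R => h (F x%:C)).
Proof.
move=> cF hB hn x; apply/cvgrPdist_lt => e e0.
have [del del0 hdel] := cF x%:C e e0.
exists del => //= x' xx'; rewrite distrC hB; apply: hn; apply: hdel.
by rewrite -rmorphB /= normcC ltcR distrC.
Qed.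

End test_functions.

Unset Implicit Arguments.

Theorem theorem4p7 (R : realType) (d : nat) (Om : set ('I_d -> R))
    (p : ('I_d -> R) -> R) (m : nat) (t : 'I_m -> 'I_d -> nat)
    (w : {ffun 'I_d -> int} -> R) :
  (0 < d)%N ->
  regular_domain Om ->
  (0 < lebV Om)%E ->
  ae_continuous_on Om p ->
  (forall k : 'I_m, lexlt (fun _ => 0%N) (t k)) ->
  (forall k1 k2 : 'I_m, (k1 < k2)%N -> lexlt (t k1) (t k2)) ->
  (forall (k : 'I_m) (v : {ffun 'I_d -> int}), v \in class_reps (t k) -> w v != 0) ->
  @eig_distributed R d (fun n => #|nodes Om n|) (fun n => Wmat t w Om p n) (d + d)
    (OmXcube Om) (fun z => p (xpart z) * symbol t w (thpart z)).
Proof.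
move=> _ hreg hpos hae t_pos t_incr _ F cF [M F0] e e0.
(* Dominated convergence concerns sequences, so the multi-index limit is refuted along one: failure
   gives for each [s] a bad [n s] with all components above [s]. *)
apply: contrapT => noN.
have bad N : exists n : 'I_d -> nat, (forall r, (N <= n r)%N) /\
    ~ `| (#|nodes Om n|)%:R^-1%:C%C * \sum_(z <- eigs (Wmat t w Om p n)) F z
       - (fine (lebV (OmXcube Om)))^-1%:C%C *
         (leb_integral (OmXcube Om) (fun y => complex.Re (F (sample_symbol p t w y)%:C%C)) +i*
          leb_integral (OmXcube Om) (fun y => complex.Im (F (sample_symbol p t w y)%:C%C)))%C |
      < e%:C%C.
  apply: contrapT => /forallNP h; apply: noN; exists N => n nN; apply: contrapT => hn.
  by apply: (h n).
pose n s := projT1 (cid (bad s.+1)).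
have nP s := projT2 (cid (bad s.+1)).
have sn s r : (s < n s r)%N by have [+ _] := nP s; exact.
have sw s := spectral_weights (@WmatC R d m t w t_pos t_incr Om p (n s)).
pose lam s := projT1 (cid (sw s)).
have sw' s := projT2 (cid (sw s)).
pose q s := projT1 (cid (sw' s)).
have qP s := projT2 (cid (sw' s)).
have q0 s b a : 0 <= q s b a by have [h _ _ _ _] := qP s; exact: h.
have q1 s b : \sum_a q s b a = 1 by have [_ h _ _ _] := qP s; exact: h.
have q1' s a : \sum_b q s b a = 1 by have [_ _ h _ _] := qP s; exact: h.
have qlam s k b : (Wmat t w Om p (n s) ^+ k) b b = \sum_a q s b a * lam s a ^+ k.
  by have [_ _ _ h _] := qP s; exact: h.
have eigsE s : \sum_(z <- eigs (Wmat t w Om p (n s))) F z = \sum_a F (lam s a)%:C%C.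
  by have [_ _ _ _ h] := qP s; exact: h.
(* [h] stands for the real or the imaginary part, both additive and bounded by the modulus. *)
have part_cvg (h : R[i] -> R) : (forall z z', h z - h z' = h (z - z')) ->
    (forall z e, `|z| < e%:C%C -> `|h z| < e) ->
    (fun s => #|nodes Om (n s)|%:R^-1 * \sum_a h (F (lam s a)%:C%C)) @ \oo -->
    (fine (lebV (OmXcube Om)))^-1 *
      leb_integral (OmXcube Om) (fun y => h (F (sample_symbol p t w y)%:C%C)).
  move=> hB hn; have ch := ccontinuous_part cF hB hn.
  have h0 x : M < `|x| -> h (F x%:C%C) = 0.
    move=> Mx; rewrite F0 ?normcC ?ltcR//.
    by rewrite -(subrr (0 : R[i])) -hB subrr.
  have [C hC] := supported_bounded ch h0.
  exact: (cvg_spectral_average hreg hpos hae sn t_pos t_incr ch hC q0 q1 q1' qlam).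
have cRe := part_cvg _ (fun z z' => esym (raddfB (@complex.Re R) z z')) (@Re_norm R).
have cIm := part_cvg _ (fun z z' => esym (raddfB (@complex.Im R) z z')) (@Im_norm R).
have e2 : 0 < e / 2 by rewrite divr_gt0.
have /cvgrPdist_lt /(_ _ e2) nRe := cRe.
have /cvgrPdist_lt /(_ _ e2) nIm := cIm.
have [s [hRe hIm]] := filter_ex (filterI nRe nIm).
have [_ ] := nP s; apply.
rewrite -/(n s) eigsE.
set I1 := leb_integral _ _ in hRe *; set I2 := leb_integral _ _ in hIm *.
set N1 := #|_|%:R^-1 in hRe hIm *; set L1 := _^-1 in hRe hIm *.
rewrite (_ : _ - _ = ((N1 * \sum_a complex.Re (F (lam s a)%:C%C) - L1 * I1) +i*
  (N1 * \sum_a complex.Im (F (lam s a)%:C%C) - L1 * I2))%C).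
  by apply: normc_lt; rewrite distrC.
rewrite -!(raddf_sum (@complex.Re R)) -!(raddf_sum (@complex.Im R)).
move: (\sum_a _) => [x y] /=.
by apply/eqP; rewrite eq_complex /= !mul0r !subr0 !addr0 !eqxx.
Qed.
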